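(* Let $\omega>2$ be a fixed integer independent of $n$. There is a polynomial time approximation scheme for the Maximum Independent Set problem in 2-dimensional Line of Sight networks with range parameter $\omega$ (presented with their embedding in $\mathbb{Z}^2_n$) that, for any $\epsilon>0$, returns a $(1+\epsilon)$-approximation in time $$O\left(n^2\,\omega^{\frac{\omega}{\epsilon}-1}\left(\tfrac1\epsilon\right)^{\frac1\epsilon}\right).$$
   Context: $\mathbb{Z}^2_n=\{1,\dots,n\}^2$. Two distinct points share a line of sight if their coordinates differ in exactly one place. A vertex-weighted graph $G=(V,E,w)$ (positive weights) is a 2-dimensional Line of Sight (LoS) network with range parameter $\omega$ if there is an embedding (injective map) $f_G:V\to\mathbb{Z}^2_n$ such that $\{u,v\}\in E$ if and only if $f_G(u)$ and $f_G(v)$ share a line of sight and their Manhattan distance is less than $\omega$. The Maximum Independent Set (MIS) problem asks for an independent set maximizing the sum of the weights of its elements. A $(1+\epsilon)$-approximation is an independent set whose total weight is at least $1/(1+\epsilon)$ times the optimum. *)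

(* Defs.v *)
From HB Require Import structures.
From mathcomp Require Import all_boot all_order all_algebra.
From mathcomp Require Import reals exp.

Set Implicit Arguments.
Unset Strict Implicit.
Unset Printing Implicit Defensive.

Import Order.TTheory GRing.Theory Num.Theory.
Local Open Scope ring_scope.

(** * Vertex-weighted graphs and independent sets *)

Record wgraph (R : realType) := WGraph {
  vertex : finType;
  edge : rel vertex;
  weight : vertex -> R;
  edge_sym : symmetric edge;
  edge_irr : irreflexive edge;
  weight_gt0 : forall v, 0 < weight v }.

Section Graphs.
Context (R : realType) (G : wgraph R).

Definition independent (S : {set vertex G}) : bool :=
  [forall u in S, forall v in S, ~~ edge u v].

Definition set_weight (S : {set vertex G}) : R := \sum_(v in S) weight v.

(* The empty set is independent and weights are positive, so the default
   value 0 does not affect the maximum. *)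
Definition mis_opt : R :=
  \big[Num.max/0]_(S : {set vertex G} | independent S) set_weight S.

Definition mis_approx (eps : R) (S : {set vertex G}) : Prop :=
  independent S /\ (1 + eps)^-1 * mis_opt <= set_weight S.

End Graphs.

(** * Line of sight networks in the grid {1, ..., n}^2 *)

Definition in_grid (n : nat) (p : nat * nat) : bool :=
  (0 < p.1 <= n)%N && (0 < p.2 <= n)%N.

Definition line_of_sight (p q : nat * nat) : bool :=
  (p.1 != q.1) (+) (p.2 != q.2).

(* On each coordinate one of the two truncated differences is 0. *)
Definition manhattan (p q : nat * nat) : nat :=
  ((p.1 - q.1) + (q.1 - p.1) + ((p.2 - q.2) + (q.2 - p.2)))%N.

Definition LoS_embedding (R : realType) (n omega : nat) (G : wgraph R)
    (f : vertex G -> nat * nat) : Prop :=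
  [/\ injective f,
      forall v, in_grid n (f v)
    & forall u v, edge u v =
        line_of_sight (f u) (f v) && (manhattan (f u) (f v) < omega)%N].

(** * The machine model

   A random access machine with additive integer arithmetic and exact real
   cells, in structured form.  A memory consists of integer arrays and real
   arrays, both named by numbers; a scalar variable is a cell of an array.
   Integers can be added, subtracted (truncated at 0) and compared; reals can
   be added, subtracted and compared.  There is no unit-cost multiplication,
   and no way to turn a real into an integer other than by comparisons. *)

Inductive iexp :=
  | INum of nat
  | IGet of nat & iexp          (* array name, index *)
  | IAdd of iexp & iexp
  | ISub of iexp & iexp.

Inductive rexp :=
  | RZero
  | ROne
  | RGet of nat & iexp          (* array name, index *)
  | RAdd of rexp & rexp
  | RSub of rexp & rexp.

Inductive bexp :=
  | ILe of iexp & iexp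
  | RLe of rexp & rexp
  | BNot of bexp
  | BAnd of bexp & bexp.

Inductive cmd :=
  | Skip
  | ISet of nat & iexp & iexp   (* array name, index, new value *)
  | RSet of nat & iexp & rexp   (* array name, index, new value *)
  | Seq of cmd & cmd
  | If of bexp & cmd & cmd
  | While of bexp & cmd.

Section Semantics.
Context (R : realType).

Record memory := Memory {
  icell : nat -> nat -> nat;
  rcell : nat -> nat -> R }.

Definition upd (T : Type) (m : nat -> nat -> T) (a i : nat) (x : T) :=
  fun b j => if (b == a) && (j == i) then x else m b j.

Fixpoint ieval (s : memory) (e : iexp) : nat :=
  match e with
  | INum k => k
  | IGet a e1 => icell s a (ieval s e1)
  | IAdd e1 e2 => (ieval s e1 + ieval s e2)%N
  | ISub e1 e2 => (ieval s e1 - ieval s e2)%N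
  end.

Fixpoint reval (s : memory) (e : rexp) : R :=
  match e with
  | RZero => 0
  | ROne => 1
  | RGet a e1 => rcell s a (ieval s e1)
  | RAdd e1 e2 => reval s e1 + reval s e2
  | RSub e1 e2 => reval s e1 - reval s e2
  end.

Fixpoint beval (s : memory) (b : bexp) : bool :=
  match b with
  | ILe e1 e2 => (ieval s e1 <= ieval s e2)%N
  | RLe e1 e2 => reval s e1 <= reval s e2
  | BNot b1 => ~~ beval s b1
  | BAnd b1 b2 => beval s b1 && beval s b2
  end.

(* [exec c s t s']: from [s], the command [c] terminates in [s'] after [t]
   steps.  Each assignment, skip and evaluation of a test counts for one step;
   as the expressions of a program have a fixed size, charging every
   elementary operation instead would change the running time by at most a
   constant factor depending on the program. *)
Inductive exec : cmd -> memory -> nat -> memory -> Prop :=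
  | exec_skip s : exec Skip s 1 s
  | exec_iset a e1 e2 s :
      exec (ISet a e1 e2) s 1
        (Memory (upd (icell s) a (ieval s e1) (ieval s e2)) (rcell s))
  | exec_rset a e1 e2 s :
      exec (RSet a e1 e2) s 1
        (Memory (icell s) (upd (rcell s) a (ieval s e1) (reval s e2)))
  | exec_seq c1 c2 s1 s2 s3 t1 t2 :
      exec c1 s1 t1 s2 -> exec c2 s2 t2 s3 ->
      exec (Seq c1 c2) s1 (t1 + t2)%N s3
  | exec_if b c1 c2 s t s' :
      exec (if beval s b then c1 else c2) s t s' ->
      exec (If b c1 c2) s t.+1 s'
  | exec_while_false b c s :
      ~~ beval s b -> exec (While b c) s 1 s
  | exec_while_true b c s1 s2 s3 t1 t2 :
      beval s1 b -> exec c s1 t1 s2 -> exec (While b c) s2 t2 s3 ->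
      exec (While b c) s1 (t1 + t2).+1 s3.

Lemma exec_det c s t1 s1 t2 s2 :
  exec c s t1 s1 -> exec c s t2 s2 -> t1 = t2 /\ s1 = s2.
Proof.
move=> H; elim: H t2 s2 => {c s t1 s1}.
- by move=> s t2 s2 H; inversion H.
- by move=> a e1 e2 s t2 s2 H; inversion H.
- by move=> a e1 e2 s t2 s2 H; inversion H.
- move=> c1 c2 s1 s2 s3 t1 t2 _ IH1 _ IH2 t s H.
  inversion H as [| | |? ? ? u ? ? ? E1 E2| | |]; subst.
  have [? ?] := IH1 _ _ E1; subst.
  by have [-> ->] := IH2 _ _ E2.
- move=> b c1 c2 s t s' _ IH t2 s2 H.
  inversion H as [| | | |? ? ? ? ? ? E| |]; subst.
  by have [-> ->] := IH _ _ E.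
- move=> b c s /negbTE nb t2 s2 H.
  inversion H as [| | | | | |? ? ? ? ? ? ? E ? ?] => //.
  by rewrite nb in E.
- move=> b c s1 s2 s3 t1 t2 b1 _ IH1 _ IH2 t s H.
  inversion H as [| | | | |? ? ? E|? ? ? u ? ? ? E E1 E2]; subst.
    by rewrite b1 in E.
  have [? ?] := IH1 _ _ E1; subst.
  by have [-> ->] := IH2 _ _ E2.
Qed.

(** ** Encoding of instances

   The vertices are numbered 0, ..., m - 1 by [enum_rank].
   Integer arrays: 0 holds n and m; 1 and 2 hold the two coordinates of the
   embedded vertices.  Real arrays: 0 holds eps; 1 holds the weights.
   All other cells are 0.  The edges are not listed: the embedding
   determines them. *)

Definition input_memory (n : nat) (eps : R) (G : wgraph R)
    (f : vertex G -> nat * nat) : memory :=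
  let vs := enum (vertex G) in
  Memory
    (fun a i => match a with
                | 0 => nth 0%N [:: n; #|vertex G|] i
                | 1 => nth 0%N [seq (f v).1 | v <- vs] i
                | 2 => nth 0%N [seq (f v).2 | v <- vs] i
                | _ => 0%N
                end)
    (fun a i => match a with
                | 0 => nth 0 [:: eps] i
                | 1 => nth 0 [seq weight v | v <- vs] i
                | _ => 0
                end).

(* The program answers by marking the chosen vertices in integer array 3. *)
Definition output_set (G : wgraph R) (s : memory) : {set vertex G} :=
  [set v | icell s 3 (enum_rank v) != 0%N].

(* [P] is one program for all instances and all accuracies: eps is part of
   its input. *)
Definition mis_scheme (omega : nat) (P : cmd) (T : nat -> R -> R) : Prop :=
  forall (n : nat) (eps : R) (G : wgraph R) (f : vertex G -> nat * nat),
    (0 < n)%N -> 0 < eps -> LoS_embedding n omega f ->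
    exists (t : nat) (s : memory),
      [/\ exec P (input_memory n eps f) t s,
          t%:R <= T n eps
        & mis_approx eps (output_set G s)].

Definition poly_bounded (g : nat -> R) : Prop :=
  exists (c : R) (d : nat), forall n, (0 < n)%N -> g n <= c * n%:R ^+ d.

Definition mis_PTAS (omega : nat) (P : cmd) (T : nat -> R -> R) : Prop :=
  mis_scheme omega P T /\
  forall eps : R, 0 < eps -> poly_bounded (fun n => T n eps).

End Semantics.

(* Main.v *)
(* Put g = omega - 1, let K be the least integer with K * eps >= 1, and let
   L = g * (K + 1).  For each of the L shifts s, delete the rows x with
   (x + s) mod L < g.  The remaining strips of K * g rows are independent of one
   another.  Keep the deleted rows as empty padding, put g empty columns between
   consecutive strips and read everything column by column: two surviving
   vertices are then adjacent exactly if their positions on this line differ by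
   1, ..., g or by L, 2 L, ..., g L.  A dynamic program whose state is the set of
   selected positions among the last g * L ones solves the shifted instance
   exactly.  A vertex survives L - g = K * g of the L shifts, so the best shift
   has weight at least K / (K + 1) >= 1 / (1 + eps) times the optimum.

   The running time is O(n^2 A^(1/eps)) with A depending on omega only, and
   x ln (A / x) <= A gives A^x <= e^A x^x, which absorbs A into the factor
   (1/eps)^(1/eps). *)

Require Import Defs.
From mathcomp Require Import all_boot all_order all_algebra.
From mathcomp Require Import reals exp.
From mathcomp Require Import sequences zify lra ring.

Set Implicit Arguments.
Unset Strict Implicit.
Unset Printing Implicit Defensive.

Import Order.TTheory GRing.Theory Num.Theory.
Local Open Scope ring_scope.

(** * Timed total correctness for the machine *)

Section Runs.
Context {R : realType}.
Implicit Types (s : memory R) (Q : memory R -> Prop).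

Definition runs c s (T : nat) Q :=
  exists t s', [/\ exec c s t s', (t <= T)%N & Q s'].

Lemma runs_seq c1 c2 s T1 T2 Q :
  runs c1 s T1 (fun s1 => runs c2 s1 T2 Q) -> runs (Seq c1 c2) s (T1 + T2)%N Q.
Proof.
move=> [t1 [s1 [E1 le1 [t2 [s2 [E2 le2 Qs]]]]]].
by exists (t1 + t2)%N, s2; split=> //; [exact: exec_seq E1 E2 | exact: leq_add].
Qed.

Lemma runs_weaken c s T T' Q Q' : (T <= T')%N -> (forall s', Q s' -> Q' s') ->
  runs c s T Q -> runs c s T' Q'.
Proof.
move=> leT QQ' [t [s' [E le Qs]]]; exists t, s'; split=> //; last exact: QQ'.
exact: leq_trans le leT.
Qed.

Lemma runs_if b c1 c2 s T Q : runs (if beval s b then c1 else c2) s T Q ->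
  runs (If b c1 c2) s T.+1 Q.
Proof.
by move=> [t [s' [E le Qs]]]; exists t.+1, s'; split=> //; apply: exec_if.
Qed.

(** The index of the invariant fixes the number [k] of rounds. Each round pays [T] and one test; the
    extra step is the final failing test. *)
Lemma runs_while b c k T (I : nat -> memory R -> Prop) s :
    I 0%N s ->
    (forall i s', (i < k)%N -> I i s' -> beval s' b /\ runs c s' T (I i.+1)) ->
    (forall s', I k s' -> ~~ beval s' b) ->
  runs (While b c) s (k * T.+1).+1 (I k).
Proof.
move=> I0 step stop.
suff loop j i s' : (i + j)%N = k -> I i s' ->
    runs (While b c) s' (j * T.+1).+1 (I k) by exact: (loop k 0%N).
elim: j i s' => [|j IHj] i s' ijk Ii.
  rewrite addn0 in ijk; rewrite ijk in Ii.
  by exists 1%N, s'; split=> //; apply: exec_while_false; apply: stop.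
have [|bs' [t1 [s1 [E1 le1 I1]]]] := step i s' _ Ii; first by lia.
have [t2 [s2 [E2 le2 I2]]] := IHj i.+1 s1 ltac:(lia) I1.
exists (t1 + t2).+1, s2; split=> //; first exact: exec_while_true E1 E2.
by rewrite mulSn; lia.
Qed.

(** * Loop-free commands by weakest preconditions *)

Fixpoint straight c : bool :=
  match c with
  | Seq c1 c2 | If _ c1 c2 => straight c1 && straight c2
  | While _ _ => false
  | _ => true
  end.

Fixpoint steps c : nat :=
  match c with
  | Seq c1 c2 => (steps c1 + steps c2)%N
  | If _ c1 c2 => (maxn (steps c1) (steps c2)).+1
  | _ => 1%N
  end.

Fixpoint wp c Q s : Prop :=
  match c with
  | Skip => Q s
  | ISet a e1 e2 =>
      Q (Memory (upd (icell s) a (ieval s e1) (ieval s e2)) (rcell s))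
  | RSet a e1 e2 =>
      Q (Memory (icell s) (upd (rcell s) a (ieval s e1) (reval s e2)))
  | Seq c1 c2 => wp c1 (wp c2 Q) s
  | If b c1 c2 => if beval s b then wp c1 Q s else wp c2 Q s
  | While _ _ => False
  end.

Lemma runs_wp c s Q : wp c Q s -> runs c s (steps c) Q.
Proof.
elim: c s Q => [|a e1 e2|a e1 e2|c1 IH1 c2 IH2|b c1 IH1 c2 IH2|//] s Q /=.
- by move=> Qs; exists 1%N, s; split=> //; constructor.
- by move=> Qs; eexists 1%N, _; split; [constructor | |exact: Qs].
- by move=> Qs; eexists 1%N, _; split; [constructor | |exact: Qs].
- move=> /IH1 r1; apply: runs_seq; apply: runs_weaken r1 => // s'.
  exact: IH2.
- move=> w; apply: runs_if; case: (beval s b) w => [/IH1|/IH2];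
    by apply: runs_weaken => //; rewrite ?leq_maxl ?leq_maxr.
Qed.

(** * Arrays left untouched by a command, and counting loops *)

Fixpoint iwritten c : seq nat :=
  match c with
  | ISet a _ _ => [:: a]
  | Seq c1 c2 | If _ c1 c2 => iwritten c1 ++ iwritten c2
  | While _ c1 => iwritten c1
  | _ => [::]
  end.

Fixpoint rwritten c : seq nat :=
  match c with
  | RSet a _ _ => [:: a]
  | Seq c1 c2 | If _ c1 c2 => rwritten c1 ++ rwritten c2
  | While _ c1 => rwritten c1
  | _ => [::]
  end.

Record frame c s s' : Prop := Frame {
  frame_i : forall a j, a \notin iwritten c -> icell s' a j = icell s a j;
  frame_r : forall a j, a \notin rwritten c -> rcell s' a j = rcell s a j }.

Lemma exec_frame c s t s' : exec c s t s' -> frame c s s'.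
Proof.
elim=> {c s t s'} //=.
- move=> a e1 e2 s; split=> //= b j; rewrite inE /upd.
  by case: eqP.
- move=> a e1 e2 s; split=> //= b j; rewrite inE /upd.
  by case: eqP.
- move=> c1 c2 s1 s2 s3 t1 t2 _ [i1 r1] _ [i2 r2].
  by split=> a j /=; rewrite mem_cat negb_or => /andP[? ?];
    rewrite ?(i2, r2) // ?(i1, r1).
- move=> b c1 c2 s t s' _; case: (beval s b) => -[i1 r1];
  by split=> a j /=; rewrite mem_cat negb_or => /andP[? ?]; rewrite ?(i1, r1).
- move=> b c s1 s2 s3 t1 t2 _ _ [i1 r1] _ [i2 r2].
  by split=> a j /= an; rewrite ?(i2, r2) // ?(i1, r1).
Qed.

Lemma runs_frame c s T Q :
  runs c s T Q -> runs c s T (fun s' => frame c s s' /\ Q s').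
Proof.
by move=> [t [s' [E le Qs]]]; exists t, s'; split=> //; split=> //;
  apply: exec_frame E.
Qed.

Definition For v (e : iexp) c :=
  Seq (ISet v (INum 0) (INum 0))
      (While (ILe (IAdd (IGet v (INum 0)) (INum 1)) e)
             (Seq c (ISet v (INum 0) (IAdd (IGet v (INum 0)) (INum 1))))).

Lemma frame_trans c s1 s2 s3 : frame c s1 s2 -> frame c s2 s3 -> frame c s1 s3.
Proof.
by move=> [i1 r1] [i2 r2]; split=> a j na; rewrite ?(i2, r2) // ?(i1, r1).
Qed.

Definition set_counter v x s := Memory (upd (icell s) v 0 x) (rcell s).

(** The bound [e] is evaluated anew in every round, so its value is demanded in every state agreeing
    with [s] off the arrays written by the loop. A round costs [T], an increment and a test; the
    outer 2 is the initialisation and the last test. *)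
Lemma runs_for v e c k T (I : nat -> memory R -> Prop) s :
    v \notin iwritten c ->
    (forall s', frame (For v e c) s s' -> ieval s' e = k) ->
    I 0%N s ->
    (forall i s' x, I i s' -> I i (set_counter v x s')) ->
    (forall i s', (i < k)%N -> frame (For v e c) s s' -> icell s' v 0 = i ->
       I i s' -> runs c s' T (I i.+1)) ->
  runs (For v e c) s (k * T.+2).+2 (fun s' => frame (For v e c) s s' /\ I k s').
Proof.
move=> vc ek I0 Icounter step.
have fr0 x s' : frame (For v e c) s s' ->
    frame (For v e c) s (set_counter v x s').
  move=> [fi fr]; split=> a j na /=; last by rewrite fr.
  rewrite /upd; case: eqP => [av|_] /=; last by rewrite fi.
  by move: na; rewrite av /= inE eqxx.
pose J i s' := [/\ frame (For v e c) s s', icell s' v 0 = i & I i s'].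
have -> : (k * T.+2).+2 = (1 + (k * T.+2).+1)%N by [].
apply: runs_seq; eexists 1%N, _; split; [exact: exec_iset | by [] |].
apply: (@runs_weaken _ _ ((k * T.+2).+1) _ (J k)) => // [s' [//]|].
rewrite -/(set_counter v 0 s); apply: runs_while.
- split; first by apply: fr0.
    by rewrite /= /upd !eqxx.
  exact: Icounter.
- move=> i s' ik [fr vi Ii]; split; first by rewrite /= (ek _ fr) vi addn1.
  rewrite -(addn1 T); apply: runs_seq.
  apply: runs_weaken (runs_frame (step i s' ik fr vi Ii)) => // s1 [fr1 I1].
  eexists 1%N, _; split; [exact: exec_iset | by [] |].
  have v1 : icell s1 v 0 = i by rewrite (frame_i fr1).
  rewrite /= v1 addn1 -/(set_counter v i.+1 s1).
  split; [|by rewrite /= /upd !eqxx | exact: Icounter].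
  apply: fr0; apply: frame_trans fr _; case: fr1 => fi fr'; split=> a j /=.
    by rewrite inE mem_cat !negb_or => /and3P[_ ac _]; exact: fi.
  by rewrite cats0; exact: fr'.
- by move=> s' [fr vk _]; rewrite /= (ek _ fr) vk addn1 ltnn.
Qed.

End Runs.

(** * Bit windows *)

Definition bit (x i : nat) : bool := odd (x %/ 2 ^ i).

(* [shift0 W x] and [(shift0 W x).+1] shift the window [x] of [W] bits by one
   place, the new lowest bit being 0 resp. 1. *)
Definition shift0 (W x : nat) : nat := ((x + x) %% 2 ^ W)%N.

Lemma shift0_even W x : (0 < W)%N -> ~~ odd (shift0 W x).
Proof.
case: W => // W _; rewrite /shift0 addnn expnS -muln2 (mulnC x) -muln_modr.
by rewrite oddM.
Qed.

Lemma shift0_lt W x : (shift0 W x < 2 ^ W)%N.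
Proof. by rewrite ltn_mod expn_gt0. Qed.

Lemma shift1_lt W x : (0 < W)%N -> ((shift0 W x).+1 < 2 ^ W)%N.
Proof.
move=> W0; rewrite ltn_neqAle shift0_lt andbT; apply/eqP => e.
have := congr1 odd e; rewrite oddS (negbTE (shift0_even x W0)) oddX /=.
by rewrite orbF eqn0Ngt W0.
Qed.

(** A doubled window is below twice [2 ^ W], so one comparison and one subtraction replace the
    reduction modulo [2 ^ W]; this is what [c_double] executes. *)
Lemma shift0E W x : (x < 2 ^ W)%N ->
  shift0 W x = (if 2 ^ W <= x + x then x + x - 2 ^ W else x + x)%N.
Proof.
move=> xW; rewrite /shift0; case: leqP => h; last by rewrite modn_small.
rewrite -[in LHS](subnK h) modnDr modn_small //; lia.
Qed.

Lemma bit_modn W x i : (i < W)%N -> bit (x %% 2 ^ W) i = bit x i.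
Proof.
move=> iW; rewrite /bit [in RHS](divn_eq x (2 ^ W)).
(* The multiple of [2 ^ W] contributes [q * 2 ^ (W - i)] to the quotient by [2 ^ i], an even number
   because [i < W]. *)
have -> q r : (q * 2 ^ W + r = q * 2 ^ (W - i) * 2 ^ i + r)%N.
  by rewrite -mulnA -expnD subnK // ltnW.
rewrite divnMDl ?expn_gt0 //.
by rewrite oddD oddM oddX subn_eq0 leqNgt iW /= andbF.
Qed.

Lemma bit_shift W x (b : bool) i : (i < W)%N ->
  bit (shift0 W x + b) i = if i is j.+1 then bit x j else b.
Proof.
move=> iW; have W0 : (0 < W)%N by case: (W) iW.
case: i iW => [_|i iW].
  by rewrite /bit expn0 divn1 oddD (negbTE (shift0_even x W0)) oddb.
have half : ((shift0 W x + b) %/ 2 = shift0 W x %/ 2)%N.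
  have := shift0_even x W0; rewrite !divn2 halfD oddb => /negbTE -> /=.
  by case: (b); rewrite add0n addn0.
rewrite /bit expnS divnMA half -divnMA -expnS -/(bit _ _) bit_modn //.
by rewrite /bit expnS divnMA addnn divn2 doubleK.
Qed.

Lemma bit_top i x : (x < 2 ^ i)%N -> bit (2 ^ i + x)%N i.
Proof.
by move=> h; rewrite /bit -{1}(mul1n (2 ^ i)%N) divnMDl ?expn_gt0 // divn_small.
Qed.

Lemma bit_addtop i j x : (j < i)%N -> bit (2 ^ i + x)%N j = bit x j.
Proof.
by move=> ji; rewrite -(bit_modn _ ji) modnDl bit_modn.
Qed.

Lemma bit_small i x : (x < 2 ^ i)%N -> bit x i = false.
Proof. by move=> h; rewrite /bit divn_small. Qed.

(** * Maximum weight selections on a line with forbidden distances *)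

Section Line.
Context {R : realType} (W N : nat) (D : pred nat) (w : nat -> R).
(** Bit [j] of a window stands for the position [j + 1] further on, so [D j] speaks of the distance
    [j + 1]. The number [i] of inspected bits varies because the table of [clear] is built by
    doubling. *)
Definition clear (i x : nat) : bool := [forall j : 'I_i, D j ==> ~~ bit x j].

Lemma clear0 x : clear 0 x.
Proof. by apply/forallP => -[]. Qed.

Lemma clearS_low i x : (x < 2 ^ i)%N -> clear i.+1 x = clear i x.
Proof.
move=> h; apply/forallP/forallP => H j.
  exact: (H (widen_ord (leqnSn _) j)).
have [ji|] := ltnP j i; first exact: (H (Ordinal ji)).
move=> ij; have -> : j = i :> nat by have := ltn_ord j; lia.
by rewrite bit_small // implybT.
Qed.

Lemma clearS_top i x : (x < 2 ^ i)%N ->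
  clear i.+1 (2 ^ i + x)%N = ~~ D i && clear i x.
Proof.
move=> h; apply/forallP/andP => [H|[nD /forallP H] j].
  split; first by have := H ord_max; rewrite /= bit_top // implybF.
  apply/forallP => j; have := H (widen_ord (leqnSn _) j).
  by rewrite /= bit_addtop.
have [ji|] := ltnP j i.
  by have := H (Ordinal ji); rewrite bit_addtop.
move=> ij; have -> : j = i :> nat by have := ltn_ord j; lia.
by rewrite (negbTE nD).
Qed.

Hypothesis W_gt0 : (0 < W)%N.

(* [dp k x] is the best weight of a selection among the positions below [k],
   when bit [i] of [x] tells whether position [k + i] is selected. *)
Fixpoint dp (k x : nat) : R :=
  if k is k'.+1 then
    if clear W x && (dp k' (shift0 W x) <= w k' + dp k' (shift0 W x).+1)
    then w k' + dp k' (shift0 W x).+1 else dp k' (shift0 W x)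
  else 0.

Definition takes (k x : nat) : bool :=
  clear W x && (dp k (shift0 W x) <= w k + dp k (shift0 W x).+1).

Lemma dpS k x : dp k.+1 x =
  if takes k x then w k + dp k (shift0 W x).+1 else dp k (shift0 W x).
Proof. by []. Qed.

(** Positions are decided from [N - 1] downwards: after [j] decisions, bit [i] is the decision on
    [N - j + i], the latest one being the lowest bit. *)
Fixpoint window (c : nat -> bool) (j : nat) : nat :=
  if j is j'.+1 then (shift0 W (window c j') + c (N - j))%N else 0%N.

Lemma window_lt c j : (window c j < 2 ^ W)%N.
Proof.
case: j => [|j] /=; first by rewrite expn_gt0.
by case: (c _); rewrite ?addn1 ?addn0 ?shift1_lt ?shift0_lt.
Qed.

Lemma bit_window c j i : (i < W)%N -> (j <= N)%N ->
  bit (window c j) i = (i < j)%N && c (N - j + i)%N.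
Proof.
elim: j i => [|j IHj] i iW jN; first by rewrite /bit div0n.
rewrite [window _ _]/= bit_shift //; case: i iW => [|i] iW; first by rewrite addn0.
by rewrite IHj //; [congr (_ && c _); lia | lia | lia].
Qed.

Definition valid (c : nat -> bool) : Prop :=
  forall k d, (d < W)%N -> D d -> (k + d.+1 < N)%N ->
    c k -> c (k + d.+1)%N -> false.

Lemma clear_window c j : (j < N)%N ->
  reflect (forall d, (d < W)%N -> D d -> (d < j)%N -> ~~ c (N - j + d)%N)
          (clear W (window c j)).
Proof.
move=> jN; apply: (iffP forallP) => H.
  move=> d dW Dd dj; have := H (Ordinal dW).
  by rewrite Dd bit_window //= ?dj //; lia.
move=> d; apply/implyP => Dd; rewrite bit_window //; last by lia.
by case: ltnP => //= dj; apply: H.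
Qed.

(** Induction on [k], with the positions from [k] on recorded in a window. Validity makes the window
    of a selected position clear, and [dp] then takes the better alternative. *)
Lemma dp_ge c : valid c -> \sum_(0 <= k < N) (if c k then w k else 0) <= dp N 0.
Proof.
move=> cv; suff H k : (k <= N)%N ->
  \sum_(0 <= k' < k) (if c k' then w k' else 0) <= dp k (window c (N - k)).
  by have := H N (leqnn N); rewrite subnn.
elim: k => [|k IHk] kN; first by rewrite big_nil.
rewrite big_nat_recr //= -/(takes k _).
have := IHk (ltnW kN); have -> : (N - k = (N - k.+1).+1)%N by lia.
move=> /=; set x := window c (N - k.+1).
have -> : (N - (N - k.+1).+1 = k)%N by lia.
case: (boolP (c k)) => ck; last first.
  rewrite addn0 addr0 => h; apply: (le_trans h).
  by rewrite /takes; case: (boolP (_ && _)) => [/andP[]|].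
rewrite addn1 addrC => h.
have cl : clear W x.
  apply/clear_window; first by lia.
  move=> d dW Dd dj; apply/negP => cd.
  move: cd; rewrite (_ : (N - (N - k.+1) + d = k + d.+1)%N); last by lia.
  by move=> /(cv k d dW Dd ltac:(lia) ck).
rewrite /takes cl /=; case: (leP (dp k (shift0 W x))) => [_|/ltW le].
  by rewrite lerD2l.
by apply: le_trans le; rewrite lerD2l.
Qed.

(** The windows met when following [takes] downwards from the empty window. They are defined before
    the selection that they produce; [traceE] identifies them with the windows of [choice]. *)
Fixpoint trace (j : nat) : nat :=
  if j is j'.+1 then
    (shift0 W (trace j') + takes (N - j) (trace j'))%N
  else 0%N.

Definition choice (k : nat) : bool := takes k (trace (N - k.+1)).

Lemma traceE j : (j <= N)%N -> trace j = window choice j.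
Proof.
elim: j => //= j IHj jN; rewrite -IHj; last by lia.
by congr (_ + _)%N; rewrite /choice; congr (nat_of_bool (takes _ (trace _))); lia.
Qed.

Lemma choice_valid : valid choice.
Proof.
move=> k d dW Dd kd; rewrite /choice {1}/takes => /andP[+ _].
rewrite traceE; last by lia.
move/clear_window => /(_ ltac:(lia) d dW Dd ltac:(lia)) /negP.
by rewrite (_ : (N - (N - k.+1) + d = k + d.+1)%N) //; lia.
Qed.

Lemma choice_sum : \sum_(0 <= k < N) (if choice k then w k else 0) = dp N 0.
Proof.
suff H k : (k <= N)%N ->
  \sum_(0 <= k' < k) (if choice k' then w k' else 0) = dp k (trace (N - k)).
  by rewrite H // subnn.
elim: k => [|k IHk] kN; first by rewrite big_nil.
rewrite big_nat_recr //= -/(takes k _) IHk; last by lia.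
have -> : (N - k = (N - k.+1).+1)%N by lia.
rewrite /= -/(takes k _) (_ : (N - (N - k.+1).+1 = k)%N); last by lia.
rewrite -/(choice k) /choice.
by case: (takes _ _); rewrite ?addn1 ?addn0 ?addr0 // addrC.
Qed.

End Line.

(** * Flattening the strips of the grid *)

Section Flatten.
Variables (n g L : nat).
Hypothesis L_gt0 : (0 < L)%N.

(* Row offset of the shifted row [r]: consecutive strips of [L] rows start
   [n + g] columns of [L] cells apart. *)
Definition row_pos (r : nat) : nat := (r %/ L * ((n + g) * L) + r %% L)%N.

Definition pos (r y : nat) : nat := (row_pos r + y * L)%N.

Definition kept (r : nat) : bool := (g <= r %% L)%N.

(** The argument is the distance minus one. Distances up to [g] are steps within a column, multiples
    of [L] steps within a row; the cut at [g * L] comes from the window size. *)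
Definition forbidden (d : nat) : bool := (d < g)%N || (d.+1 %% L == 0)%N.

Lemma posE r y : pos r y = ((r %/ L * (n + g) + y) * L + r %% L)%N.
Proof. by rewrite /pos /row_pos mulnA mulnDl addnAC. Qed.

Lemma modn_divnS r : (r.+1 %% L = if (r %% L).+1 < L then (r %% L).+1 else 0)%N
  /\ (r.+1 %/ L = if (r %% L).+1 < L then r %/ L else (r %/ L).+1)%N.
Proof.
have rL : (r %% L < L)%N by rewrite ltn_mod.
have e : r.+1 = (r %/ L * L + (r %% L).+1)%N by rewrite addnS -divn_eq.
rewrite e modnMDl divnMDl //; case: ltnP => h.
  by rewrite (modn_small h) (divn_small h) addn0.
by rewrite (_ : (r %% L).+1 = L) ?modnn ?divnn ?L_gt0 ?addn1 //; lia.
Qed.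

(** The recursion by which [c_rows] fills its table without multiplication or division, and the
    source of monotonicity. At the end of a strip it jumps to the block of the next one. *)
Lemma row_posS r : (0 < n + g)%N -> row_pos r.+1 =
  (if (r %% L).+1 < L then (row_pos r).+1
   else (row_pos r).+1 + ((n + g) * L - L))%N.
Proof.
move=> H0; rewrite /row_pos; have [-> ->] := modn_divnS r.
case: ltnP => h; first by rewrite addnS.
have rL : (r %% L < L)%N by rewrite ltn_mod.
have : (L <= (n + g) * L)%N by rewrite leq_pmull.
by rewrite mulSn; lia.
Qed.

Lemma leq_row_pos r r' : (0 < n + g)%N -> (r <= r')%N ->
  (row_pos r <= row_pos r')%N.
Proof.
move=> H0; elim: r' => [|r' IH]; first by rewrite leqn0 => /eqP ->.
rewrite leq_eqVlt => /predU1P[-> //|/IH h]; apply: (leq_trans h).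
by rewrite row_posS //; case: ifP => _; lia.
Qed.

Lemma ltn_row_pos r r' : (0 < n + g)%N -> (r < r')%N ->
  (row_pos r < row_pos r')%N.
Proof.
move=> H0 rr'; apply: leq_trans (leq_row_pos H0 rr').
by rewrite row_posS //; case: ifP => _; lia.
Qed.

Lemma row_pos_le r : (0 < n + g)%N -> (row_pos r <= r * (n + g))%N.
Proof.
move=> H0; rewrite /row_pos [X in (_ <= X * _)%N](divn_eq r L).
move: H0; set h := (n + g)%N; set q := (r %/ L)%N; set p := (r %% L)%N => h0.
by rewrite mulnDl (mulnC h) mulnA leq_add2l leq_pmulr.
Qed.

(** Neighbours in one row differ by a multiple of [L]. Neighbours in one column lie in one strip,
    since the [g] deleted rows between strips put kept rows of different strips more than [g]
    apart. *)
Lemma edge_forbidden x y x' y' s :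
    kept (x + s) -> kept (x' + s) -> (pos (x + s) y <= pos (x' + s) y')%N ->
    line_of_sight (x, y) (x', y') -> (manhattan (x, y) (x', y') <= g)%N ->
  exists2 d, (d < g * L)%N /\ forbidden d &
    pos (x' + s) y' = (pos (x + s) y + d.+1)%N.
Proof.
rewrite /kept !posE /line_of_sight /manhattan /= /forbidden.
have := divn_eq (x + s) L; have := divn_eq (x' + s) L.
have := ltn_pmod (x + s) L_gt0; have := ltn_pmod (x' + s) L_gt0.
set q := ((x + s) %/ L)%N; set q' := ((x' + s) %/ L)%N.
set p := ((x + s) %% L)%N; set p' := ((x' + s) %% L)%N => pL' pL e' e kp kp' le.
have [xx|nxx] := eqVneq x x'; have [yy|nyy] //= := eqVneq y y'.
- have qq : q' = q by rewrite /q /q' xx.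
  have pp : p' = p by rewrite /p /p' xx.
  rewrite xx !subnn !add0n => _ mh.
  have ly : (y < y')%N.
    rewrite ltn_neqAle nyy /=; move: le.
    by rewrite qq pp leq_add2r leq_pmul2r // leq_add2l.
  exists ((y' - y) * L).-1; last first.
    rewrite prednK ?muln_gt0 ?subn_gt0 ?ly // qq pp.
    rewrite -[in LHS](subnKC (ltnW ly)) addnA mulnDl; lia.
  rewrite prednK ?muln_gt0 ?subn_gt0 ?ly // modnMl eqxx orbT; split=> //.
  by rewrite leq_pmul2r //; lia.
- rewrite yy !subnn !addn0 => _ mh.
  have qq : q' = q.
    apply/eqP; rewrite eqn_leq; apply/andP; split; rewrite leqNgt; apply/negP => lt.
      have : (q.+1 * L <= q' * L)%N by rewrite leq_pmul2r.
      by rewrite mulSn; lia.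
    have : (q'.+1 * L <= q * L)%N by rewrite leq_pmul2r.
    by rewrite mulSn; lia.
  rewrite qq yy in e' le *.
  exists (p' - p).-1; last by lia.
  have g0 : (g <= g * L)%N by rewrite leq_pmulr.
  by split; [lia | apply/orP; left; lia].
Qed.

(** Both kinds of padding enter: a distance up to [g] cannot change the column, as it would end in
    deleted rows, and columns at most [g] apart cannot lie in different strips, as [g] empty columns
    separate these. *)
Lemma forbidden_edge x y x' y' s d :
    (0 < y <= n)%N -> (0 < y' <= n)%N -> kept (x + s) -> kept (x' + s) ->
    (d < g * L)%N -> forbidden d -> pos (x' + s) y' = (pos (x + s) y + d.+1)%N ->
  line_of_sight (x, y) (x', y') && (manhattan (x, y) (x', y') <= g)%N.
Proof.
rewrite /kept !posE /line_of_sight /manhattan /= /forbidden.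
have := divn_eq (x + s) L; have := divn_eq (x' + s) L.
have := ltn_pmod (x + s) L_gt0; have := ltn_pmod (x' + s) L_gt0.
set q := ((x + s) %/ L)%N; set q' := ((x' + s) %/ L)%N.
set p := ((x + s) %% L)%N; set p' := ((x' + s) %% L)%N.
move=> pL' pL e' e /andP[y0 yn] /andP[y0' yn'] kp kp' dL dF E.
have same_strip c c' : (0 < c <= n)%N -> (0 < c' <= n)%N ->
    (q * (n + g) + c <= q' * (n + g) + c')%N ->
    (q' * (n + g) + c' <= q * (n + g) + c + g)%N -> q' = q.
  move=> hc hc' h1 h2; apply/eqP; rewrite eqn_leq.
  apply/andP; split; rewrite leqNgt; apply/negP => lt.
    have : (q.+1 * (n + g) <= q' * (n + g))%N by rewrite leq_mul2r lt orbT.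
    by rewrite mulSn; lia.
  have : (q'.+1 * (n + g) <= q * (n + g))%N by rewrite leq_mul2r lt orbT.
  by rewrite mulSn; lia.
case: (ltnP d g) dF => [dg _|gd /= /eqP dF].
  have cc : (q' * (n + g) + y' = q * (n + g) + y)%N.
    move: E; set c := (q * _ + y)%N; set c' := (q' * _ + y')%N => E.
    apply/eqP; rewrite eqn_leq; apply/andP; split; rewrite leqNgt; apply/negP => lt.
      have : (c.+1 * L <= c' * L)%N by rewrite leq_pmul2r.
      by rewrite mulSn; lia.
    have : (c'.+1 * L <= c * L)%N by rewrite leq_pmul2r.
    by rewrite mulSn; lia.
  have qq : q' = q.
    by apply: (same_strip y y'); rewrite ?y0 ?y0' //; lia.
  rewrite qq in cc E e'; have yy : y' = y by lia.
  rewrite yy eqxx !subnn /= in E *.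
  have -> : x != x' by apply/eqP; lia.
  lia.
(* The distance is now [j * L]: the remainders agree and the columns are [j] apart, with
   [1 <= j <= g]. *)
have [j dj] : exists j, d.+1 = (j * L)%N.
  by exists (d.+1 %/ L)%N; rewrite {1}(divn_eq d.+1 L) dF addn0.
have jg : (j <= g)%N by rewrite -(leq_pmul2r L_gt0) -dj.
have j0 : (0 < j)%N by case: (j) dj.
have {}E : ((q' * (n + g) + y') * L + p' = (q * (n + g) + y + j) * L + p)%N.
  by rewrite E dj mulnDl; lia.
have pp : p' = p.
  by have := congr1 (fun z => z %% L)%N E; rewrite !modnMDl !modn_small.
have cc : (q' * (n + g) + y' = q * (n + g) + y + j)%N.
  by apply/eqP; rewrite -(eqn_pmul2r L_gt0); apply/eqP; lia.
have qq : q' = q by apply: (same_strip y y'); rewrite ?y0 ?y0' //; lia.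
rewrite qq in cc e'.
have -> : x = x' by lia.
rewrite eqxx !subnn /=; apply/andP; split; first by apply/eqP; lia.
lia.
Qed.

(** Advancing [x] by one only moves the first term to the end. *)
Lemma sum_rotate (h : nat -> nat) x :
  (\sum_(0 <= s < L) h ((x + s) %% L) = \sum_(0 <= s < L) h s)%N.
Proof.
elim: x => [|x IH].
  by rewrite !big_mkord; apply: eq_bigr => i _; rewrite add0n modn_small.
rewrite -{}IH; case: L L_gt0 => // l _; rewrite big_nat_recr //= big_nat_recl //=.
rewrite [LHS]addnC addn0 addSnnS modnDr; congr (_ + _)%N.
by apply: eq_bigr => i _; rewrite addSnnS.
Qed.

Lemma kept_count x : (g <= L)%N -> (\sum_(0 <= s < L) kept (x + s) = L - g)%N.
Proof.
move=> gL; rewrite /kept (sum_rotate (fun p => nat_of_bool (g <= p)%N)).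
rewrite (big_cat_nat (n := g)) //= big_nat big1 ?add0n; last first.
  by move=> i /andP[_ ig]; rewrite leqNgt ig.
rewrite (eq_big_nat _ _ (F2 := fun=> 1%N)); last by move=> i /andP[-> _].
by rewrite sum_nat_const_nat muln1.
Qed.

End Flatten.

(** * Shifted instances *)

Section Shifted.
Context {R : realType} (n g L m : nat) (xs ys : nat -> nat) (ws : nat -> R).
Hypothesis g_gt0 : (0 < g)%N.
Hypothesis L_gt0 : (0 < L)%N.
Hypothesis xs_grid : forall v, (v < m)%N -> (0 < xs v <= n)%N.
Hypothesis ys_grid : forall v, (v < m)%N -> (0 < ys v <= n)%N.
Hypothesis ws_ge0 : forall v, (v < m)%N -> 0 <= ws v.

Definition width : nat := (g * L)%N.
(** Shifted rows [xs v + s] stay below [n + L] and columns are at most [n], so this exceeds every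
    occurring position. *)
Definition cells : nat := (row_pos n g L (n + L) + n * L)%N.

Definition vpos (s v : nat) : nat := pos n g L (xs v + s) (ys v).
Definition vkept (s v : nat) : bool := kept g L (xs v + s).

Definition cell_weight (s t : nat) : R :=
  \sum_(0 <= v < m) if vkept s v && (vpos s v == t) then ws v else 0.

Definition near (u v : nat) : bool :=
  line_of_sight (xs u, ys u) (xs v, ys v)
    && (manhattan (xs u, ys u) (xs v, ys v) <= g)%N.

Definition indep (o : nat -> bool) : Prop :=
  forall u v, (u < m)%N -> (v < m)%N -> o u -> o v -> ~~ near u v.

Definition mass (o : nat -> bool) : R :=
  \sum_(0 <= v < m) if o v then ws v else 0.

Definition value (s : nat) : R :=
  dp width (forbidden g L) (cell_weight s) cells 0.

Definition selected (s v : nat) : bool :=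
  vkept s v &&
  choice width cells (forbidden g L) (cell_weight s) (vpos s v).

Let width_gt0 : (0 < width)%N. Proof. by rewrite muln_gt0 g_gt0. Qed.

Lemma near_sym u v : near u v = near v u.
Proof.
rewrite /near /line_of_sight /manhattan /= (eq_sym (xs u)) (eq_sym (ys u)).
by rewrite (addnC (xs u - xs v)%N) (addnC (ys u - ys v)%N).
Qed.

Lemma vpos_lt s v : (s < L)%N -> (v < m)%N -> (vpos s v < cells)%N.
Proof.
move=> sL vm; have /andP[x0 xn] := xs_grid vm; have /andP[y0 yn] := ys_grid vm.
have := @ltn_row_pos n g L L_gt0 (xs v + s) (n + L) ltac:(lia) ltac:(lia).
have : (ys v * L <= n * L)%N by rewrite leq_mul2r yn orbT.
by rewrite /vpos /cells /pos; lia.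
Qed.

Lemma sum_cells s c : (s < L)%N ->
  \sum_(0 <= t < cells) (if c t then cell_weight s t else 0) =
  mass (fun v => vkept s v && c (vpos s v)).
Proof.
move=> sL; pose F t v := if [&& vkept s v, c t & vpos s v == t] then ws v else 0.
rewrite (eq_bigr (fun t => \sum_(0 <= v < m) F t v)); last first.
  move=> t _; rewrite /F /cell_weight; case: (c t) => //.
  by rewrite big1 // => v _; rewrite andbF.
rewrite exchange_big; rewrite big_nat [RHS]big_nat; apply: eq_bigr => v /andP[_ vm].
rewrite big_mkord (bigD1 (Ordinal (vpos_lt sL vm))) //= big1 ?addr0.
  by rewrite /F eqxx andbT.
by move=> t /eqP ne; rewrite /F; case: eqP => [e|]; rewrite ?andbF //;
   case: ne; apply: val_inj.
Qed.

Lemma selected_indep s : (s < L)%N -> indep (selected s).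
Proof.
move=> sL u v um vm su sv; apply/negP.
wlog le : u v um vm su sv / (vpos s u <= vpos s v)%N.
  move=> H; case: (leqP (vpos s u) (vpos s v)) => [|/ltnW] h; first exact: H.
  by rewrite near_sym; apply: H.
move=> /andP[los mh]; case/andP: su => ku cu; case/andP: sv => kv cv.
have [d [dW Fd] E] := @edge_forbidden n g L L_gt0 _ _ _ _ s ku kv le los mh.
have EE : vpos s v = (vpos s u + d.+1)%N by [].
rewrite EE in cv.
apply: notF; apply: (choice_valid width_gt0 dW Fd _ cu cv).
by rewrite -EE; apply: vpos_lt.
Qed.

Lemma selected_mass s : (s < L)%N -> mass (selected s) = value s.
Proof. by move=> sL; rewrite /value -choice_sum // sum_cells. Qed.

(** The cells occupied by the surviving part of [o] form a valid selection: two of them at a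
    forbidden distance would carry adjacent vertices by [forbidden_edge]. *)
Lemma value_ge s o : (s < L)%N -> indep o ->
  mass (fun v => o v && vkept s v) <= value s.
Proof.
move=> sL io.
pose c t := [exists v : 'I_m, [&& o v, vkept s v & vpos s v == t]].
(* Any further vertex on an occupied cell only adds nonnegative weight. *)
apply: (@le_trans _ _ (mass (fun v => vkept s v && c (vpos s v)))).
  rewrite /mass big_nat [leRHS]big_nat; apply: ler_sum => v /andP[_ vm].
  case: (boolP (o v)) => ov /=; last by case: ifP => _ //; apply: ws_ge0.
  case: (boolP (vkept s v)) => kv //=.
  suff -> : c (vpos s v) by [].
  by apply/existsP; exists (Ordinal vm); rewrite /= ov kv eqxx.
rewrite -sum_cells //; apply: dp_ge => // k d dW Fd kd.
move=> /existsP[u /and3P[ou ku /eqP pu]] /existsP[v /and3P[ov kv /eqP pv]].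
have := io u v (ltn_ord u) (ltn_ord v) ou ov.
have -> // : near u v.
apply: (forbidden_edge L_gt0 (ys_grid (ltn_ord u)) (ys_grid (ltn_ord v)) ku kv dW Fd).
by rewrite -/(vpos s u) -/(vpos s v) pu pv.
Qed.

(* Each vertex survives exactly [L - g] of the [L] shifts. *)
Lemma shift_average o b : (g <= L)%N -> indep o ->
  (forall s, (s < L)%N -> value s <= b) ->
  (L - g)%:R * mass o <= L%:R * b.
Proof.
move=> gL io vb.
have -> : (L - g)%:R * mass o =
    \sum_(0 <= s < L) mass (fun v => o v && vkept s v).
  rewrite /mass exchange_big mulr_sumr /=; apply: eq_bigr => v _.
  case: (o v) => /=; last by rewrite mulr0 big1.
  rewrite -(kept_count L_gt0 (xs v) gL) natr_sum mulr_suml; apply: eq_bigr => s _.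
  by rewrite /vkept; case: (kept _ _ _); rewrite ?mul1r ?mul0r.
have -> : L%:R * b = \sum_(0 <= s < L) b.
  by rewrite sumr_const_nat subn0 mulr_natl.
rewrite big_nat [leRHS]big_nat; apply: ler_sum => s /andP[_ sL].
exact: le_trans (value_ge sL io) (vb s sL).
Qed.

Lemma cells_le : (0 < n)%N -> (cells <= n ^ 2 * ((1 + L) * (1 + g) + L))%N.
Proof.
move=> n0; have := @row_pos_le n g L (n + L) ltac:(lia).
rewrite /cells => h.
have h1 : (n + L <= n * (1 + L))%N.
  by rewrite mulnDr muln1 leq_add2l leq_pmull.
have h2 : (n + g <= n * (1 + g))%N.
  by rewrite mulnDr muln1 leq_add2l leq_pmull.
have h3 := leq_mul h1 h2.
have h4 : (n * L <= n ^ 2 * L)%N by rewrite leq_mul2r expnS expn1 leq_pmulr ?orbT.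
rewrite mulnDr; apply: leq_add => //; apply: leq_trans h _.
by apply: leq_trans h3 _; rewrite mulnACA expnS expn1.
Qed.

End Shifted.

(** * The program *)

(* Names of arrays; the names in [v] are integer scalars, stored at index 0.
   [aRow] holds [row_pos], [aRem] remainders modulo [L], [aCol] multiples of
   [L], [aOff] multiples of [S = 2 ^ (g * L)], and [aClear x] tells whether
   window [x] permits the next selection. *)
Local Notation aX := 1%N.
Local Notation aY := 2%N.
Local Notation aOut := 3%N.
Local Notation vL := 4%N.
Local Notation vI := 5%N.
Local Notation aRow := 6%N.
Local Notation aRem := 7%N.
Local Notation vShift := 8%N.
Local Notation vK := 9%N.
Local Notation aCol := 10%N.
Local Notation aClear := 11%N.
Local Notation vS := 12%N.
Local Notation vJ := 13%N.
Local Notation vQ := 14%N.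
Local Notation aOff := 15%N.
Local Notation vN := 16%N.
Local Notation aChoice := 17%N.
Local Notation vP := 18%N.
Local Notation vT := 19%N.
Local Notation vC := 20%N.
Local Notation rWeight := 1%N.
Local Notation rAcc := 2%N.
Local Notation rCell := 3%N.
Local Notation rDp := 4%N.
Local Notation rBest := 5%N.

Local Notation var x := (IGet x (INum 0)).
Local Notation succ e := (IAdd e (INum 1)).
Local Notation num_n := (IGet 0 (INum 0)).
Local Notation num_m := (IGet 0 (INum 1)).

(** Multiplication by a constant of the program text, unrolled into additions. *)
Fixpoint imul (k : nat) (e : iexp) : iexp :=
  if k is k'.+1 then IAdd e (imul k' e) else INum 0.

(** [rAcc] runs through the multiples of [eps] until one reaches 1, the [K]-th one, while [vL] grows
    from [g] to [g * (K + 1)]. *)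
Definition c_period (g : nat) : cmd :=
  Seq (ISet vL (INum 0) (INum g))
      (While (BNot (RLe ROne (RGet rAcc (INum 0))))
         (Seq (RSet rAcc (INum 0) (RAdd (RGet rAcc (INum 0)) (RGet 0 (INum 0))))
              (ISet vL (INum 0) (IAdd (var vL) (INum g))))).

Definition c_multiples (a step : nat) (e : iexp) : cmd :=
  Seq (ISet a (INum 0) (INum 0))
      (For vI e (ISet a (succ (var vI)) (IAdd (IGet a (var vI)) (var step)))).

Definition c_rows (g : nat) : cmd :=
  Seq (ISet aRow (INum 0) (INum 0))
  (Seq (ISet aRem (INum 0) (INum 0))
  (For vI (IAdd num_n (var vL))
     (If (ILe (var vL) (succ (IGet aRem (var vI))))
        (Seq (ISet aRem (succ (var vI)) (INum 0))
             (ISet aRow (succ (var vI))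
                (IAdd (succ (IGet aRow (var vI)))
                      (ISub (IGet aCol (IAdd num_n (INum g))) (var vL)))))
        (Seq (ISet aRem (succ (var vI)) (succ (IGet aRem (var vI))))
             (ISet aRow (succ (var vI)) (succ (IGet aRow (var vI)))))))).

(* Windows of [i + 1] bits: those below [vS = 2 ^ i] keep their entry of
   [aClear], and setting bit [i] clears the entry if distance [i + 1] is
   forbidden.  [vQ] is [i + 1] modulo [L]. *)
Definition c_clear_inner (g : nat) : cmd :=
  For vJ (var vS)
    (If (BNot (BAnd (ILe (INum g.+1) (succ (var vI))) (ILe (INum 1) (var vQ))))
       (ISet aClear (IAdd (var vS) (var vJ)) (INum 0))
       (ISet aClear (IAdd (var vS) (var vJ)) (IGet aClear (var vJ)))).

Definition c_clear_body (g : nat) : cmd :=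
  Seq (Seq (ISet vQ (INum 0) (succ (var vQ)))
           (If (ILe (var vL) (var vQ)) (ISet vQ (INum 0) (INum 0)) Skip))
  (Seq (c_clear_inner g)
       (ISet vS (INum 0) (IAdd (var vS) (var vS)))).

Definition c_clear (g : nat) : cmd :=
  Seq (Seq (ISet vS (INum 0) (INum 1))
      (Seq (ISet vQ (INum 0) (INum 0))
           (ISet aClear (INum 0) (INum 1))))
  (For vI (imul g (var vL)) (c_clear_body g)).

Definition c_prepare (g : nat) : cmd :=
  Seq (c_period g)
  (Seq (c_multiples aCol vL (IAdd num_n (INum g)))
  (Seq (c_rows g)
  (Seq (ISet vN (INum 0)
          (IAdd (IGet aRow (IAdd num_n (var vL))) (IGet aCol num_n)))
  (Seq (c_clear g)
       (c_multiples aOff vS (var vN)))))).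

Definition e_row (v : iexp) : iexp := IAdd (IGet aX v) (var vShift).
Definition e_pos (v : iexp) : iexp :=
  IAdd (IGet aRow (e_row v)) (IGet aCol (IGet aY v)).
Definition b_kept (g : nat) (v : iexp) : bexp :=
  ILe (INum g) (IGet aRem (e_row v)).

Definition c_zero (a : nat) (e : iexp) : cmd := For vI e (RSet a (var vI) RZero).

Definition c_fill (g : nat) : cmd :=
  For vI num_m
    (If (b_kept g (var vI))
       (RSet rCell (e_pos (var vI))
          (RAdd (RGet rCell (e_pos (var vI))) (RGet rWeight (var vI))))
       Skip).

Definition c_double (x : iexp) : cmd :=
  Seq (ISet vP (INum 0) (IAdd x x))
      (If (ILe (var vS) (var vP))
          (ISet vP (INum 0) (ISub (var vP) (var vS))) Skip).

Definition e_skip (k : iexp) : rexp := RGet rDp (IAdd (IGet aOff k) (var vP)).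
Definition e_take (k : iexp) : rexp :=
  RAdd (RGet rCell k) (RGet rDp (IAdd (IGet aOff k) (succ (var vP)))).
Definition b_take (k x : iexp) : bexp :=
  BAnd (ILe (INum 1) (IGet aClear x)) (RLe (e_skip k) (e_take k)).

Definition c_dp_inner : cmd :=
  For vJ (var vS)
    (Seq (c_double (var vJ))
       (If (b_take (var vK) (var vJ))
          (RSet rDp (IAdd (IGet aOff (succ (var vK))) (var vJ)) (e_take (var vK)))
          (RSet rDp (IAdd (IGet aOff (succ (var vK))) (var vJ)) (e_skip (var vK))))).

Definition c_dp : cmd := For vK (var vN) c_dp_inner.

(** The decisions are not stored by [c_dp]; the test [b_take] is repeated on the finished table
    along the single path from the empty window. *)
Definition c_trace : cmd :=
  Seq (ISet vT (INum 0) (INum 0))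
  (For vI (var vN)
    (Seq (ISet vC (INum 0) (ISub (var vN) (succ (var vI))))
    (Seq (c_double (var vT))
       (If (b_take (var vC) (var vT))
          (Seq (ISet aChoice (var vC) (INum 1))
               (ISet vT (INum 0) (succ (var vP))))
          (Seq (ISet aChoice (var vC) (INum 0))
               (ISet vT (INum 0) (var vP))))))).

(** Deleted vertices are unmarked explicitly, since an earlier shift may have marked them. *)
Definition c_output (g : nat) : cmd :=
  For vI num_m
    (If (b_kept g (var vI))
       (ISet aOut (var vI) (IGet aChoice (e_pos (var vI))))
       (ISet aOut (var vI) (INum 0))).

Definition c_update (g : nat) : cmd :=
  If (RLe (RGet rBest (INum 0)) (RGet rDp (IGet aOff (var vN))))
     (Seq (RSet rBest (INum 0) (RGet rDp (IGet aOff (var vN))))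
     (Seq c_trace (c_output g)))
     Skip.

(** The cell weights are reset because [c_fill] accumulates; zeroing the first [vS] entries of [rDp]
    provides row 0 of the table. *)
Definition c_shift (g : nat) : cmd :=
  Seq (c_zero rCell (var vN))
  (Seq (c_fill g)
  (Seq (c_zero rDp (var vS))
  (Seq c_dp (c_update g)))).

Definition scheme (g : nat) : cmd :=
  Seq (c_prepare g) (For vShift (var vL) (c_shift g)).

(** * Correctness of the period and of the auxiliary tables *)

Section Correctness.
Context {R : realType}.
Implicit Types s : memory R.

Lemma ieval_imul s k e : ieval s (imul k e) = (k * ieval s e)%N.
Proof. by elim: k => //= k ->; rewrite mulSn. Qed.

Lemma c_period_ok g K (eps : R) s :
    rcell s rAcc 0 = 0 -> rcell s 0 0 = eps ->
    (forall k, (k < K)%N -> k%:R * eps < 1) -> 1 <= K%:R * eps ->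
  runs (c_period g) s (1 + (K * 3).+1) (fun s' => icell s' vL 0 = g * K.+1)%N.
Proof.
move=> acc0 eps0 Klt Kle; apply: runs_seq; apply: runs_wp => /=.
pose I k s' := [/\ rcell s' rAcc 0 = k%:R * eps, rcell s' 0 0 = eps &
  icell s' vL 0 = (g * k.+1)%N].
apply: (@runs_weaken _ _ _ (K * 3).+1 _ (I K)) => // [s' [] //|].
apply: runs_while => [|k s' kK [a e l]|s' [a e l]].
- by split; rewrite /= ?mul0r //= /upd !eqxx muln1.
- split; first by rewrite /= a -ltNge Klt.
  apply: runs_wp; split=> //=.
    by rewrite /upd !eqxx /= a e -natr1 mulrDl mul1r.
  by rewrite /upd !eqxx /= l [in RHS]mulnS addnC.
- by rewrite /= a negbK.
Qed.

Lemma c_multiples_ok a step e k x s :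
    a != vI -> step != vI -> a != step -> icell s step 0 = x ->
    (forall s', frame (c_multiples a step e) s s' -> ieval s' e = k) ->
  runs (c_multiples a step e) s (k * 3 + 3)
    (fun s' => forall j, (j <= k)%N -> icell s' a j = j * x)%N.
Proof.
move=> aI stI ast stx ek.
pose I i s' := (forall j, (j <= i)%N -> icell s' a j = j * x)%N.
have -> : (k * 3 + 3 = 1 + (k * 3).+2)%N by lia.
apply: runs_seq; apply: runs_wp => /=.
set s1 := Memory _ _.
have fr1 : frame (c_multiples a step e) s s1.
  split=> // b j /=; rewrite inE negb_or => /andP[/negbTE ba _].
  by rewrite /upd ba.
apply: (@runs_weaken _ _ _ (k * 3).+2 _ (fun s' => frame
  (For vI e (ISet a (succ (var vI)) (IAdd (IGet a (var vI)) (var step)))) s1 s'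
    /\ I k s')) => // [s' [] //|].
apply: runs_for => /=.
- by rewrite inE eq_sym.
- move=> s' fr; apply: ek; apply: frame_trans fr1 _.
  case: fr => fi fr; split=> b j /= bn; last exact: fr.
  by apply: fi => /=; move: bn; rewrite inE negb_or => /andP[].
- by move=> j; rewrite leqn0 => /eqP ->; rewrite /= /upd !eqxx.
- by move=> i s' y Ii j ji /=; rewrite /upd (negbTE aI) Ii.
- move=> i s' ik [fi _] vi Ii; apply: runs_wp => j ji /=.
  rewrite /upd eqxx /= vi; case: eqP => [->|/eqP ne].
    have sta : step != a by rewrite eq_sym.
    rewrite Ii // fi; last by rewrite /= !inE !negb_or stI sta.
    rewrite /s1 /= /upd (negbTE sta) /= stx.
    by rewrite addn1 mulSn addnC.
  by apply: Ii; move: ji ne; rewrite addn1; lia.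
Qed.

Lemma c_rows_ok n g L s : (0 < L)%N -> (0 < n + g)%N ->
    icell s 0 0 = n -> icell s vL 0 = L -> icell s aCol (n + g) = ((n + g) * L)%N ->
  runs (c_rows g) s ((n + L) * 5 + 4)
    (fun s' => forall j, (j <= n + L)%N ->
       icell s' aRow j = row_pos n g L j /\ icell s' aRem j = j %% L)%N.
Proof.
move=> L0 H0 en eL eM.
pose I i s' := (forall j, (j <= i)%N ->
       icell s' aRow j = row_pos n g L j /\ icell s' aRem j = j %% L)%N.
have -> : ((n + L) * 5 + 4 = 1 + (1 + ((n + L) * 5).+2))%N by lia.
apply: runs_seq; apply: runs_wp; apply: runs_seq; apply: runs_wp => /=.
apply: runs_weaken (runs_for (k := (n + L)%N) (T := 3) (I := I) _ _ _ _ _) => //.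
- by move=> s' [].
- by move=> s' [fi _] /=; rewrite !fi //= /upd /= en eL.
- move=> j; rewrite leqn0 => /eqP ->; rewrite /= /row_pos div0n mod0n.
  by [].
- move=> i s' ik [fi _] vi Ii.
  have [ri qi] := Ii i (leqnn i).
  have L' : icell s' vL 0 = L by rewrite fi.
  apply: runs_wp => /=; rewrite vi L' qi.
  have n' : icell s' 0 0 = n by rewrite fi.
  have M' : icell s' aCol (n + g) = ((n + g) * L)%N by rewrite fi.
  have := row_posS L0 i H0; have [+ _] := modn_divnS L0 i.
  rewrite (leqNgt L) addn1; case: ltnP => /= h em er j ji /=.
    rewrite /upd /= !addn1 vi; case: eqP => [->|/eqP ne]; first by rewrite em er ri.
    by apply: Ii; move: ji ne; lia.
  rewrite /upd /= !addn1 n' M' vi L'; case: eqP => [->|/eqP ne].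
    by rewrite em er ri.
  by apply: Ii; move: ji ne; lia.
Qed.

End Correctness.

(** Windows of [i + 1] bits are those of [i] bits and their translates by [2 ^ i], so [clearS_low]
    and [clearS_top] double the table in each round. *)
Lemma c_clear_ok {R : realType} g L (s : memory R) : (0 < L)%N -> icell s vL 0 = L ->
  let W := (g * L)%N in
  runs (c_clear g) s (3 + (W * (3 + ((2 ^ W * 4).+2 + 1)).+2).+2)%N
    (fun s' => icell s' vS 0 = (2 ^ W)%N /\
       forall x, (x < 2 ^ W)%N -> icell s' aClear x = clear (forbidden g L) W x).
Proof.
move=> L0 eL W; set D := forbidden g L.
apply: runs_seq; apply: runs_wp => /=.
pose I i (s' : memory R) := [/\ icell s' vS 0 = (2 ^ i)%N, icell s' vQ 0 = (i %% L)%N &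
  forall x, (x < 2 ^ i)%N -> icell s' aClear x = clear D i x].
apply: runs_weaken (runs_for (k := W) (T := (3 + ((2 ^ W * 4).+2 + 1))%N)
  (I := I) _ _ _ _ _) => //.
- by move=> s' [_ []].
- by move=> s' [fi _]; rewrite ieval_imul /= fi //= /upd /= eL.
- by split; rewrite /= /upd //= ?mod0n // => -[|//] _; rewrite clear0.
move=> i s' iW [fi _] vi [Si Qi Ci].
have L' : icell s' vL 0 = L by rewrite fi // /upd /= eL.
apply: runs_seq.
apply: (@runs_weaken _ _ _ 3 _ (fun s1 : memory R =>
    [/\ icell s1 vI 0 = i, icell s1 vQ 0 = (i.+1 %% L)%N, icell s1 vS 0 = (2 ^ i)%N &
    forall x, (x < 2 ^ i)%N -> icell s1 aClear x = clear D i x])) => //; last first.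
  apply: runs_wp => /=; rewrite /upd /= L' Qi addn1.
  have [-> _] := modn_divnS L0 i; rewrite leqNgt.
  by case: ltnP => /= _; split=> //=; rewrite Qi addn1.
move=> s1 [vi1 Q1 S1 C1]; apply: runs_seq.
pose J j (s' : memory R) :=
  (forall x, (x < 2 ^ i)%N -> icell s' aClear x = clear D i x) /\
  (forall x, (x < j)%N -> icell s' aClear (2 ^ i + x) = clear D i.+1 (2 ^ i + x)%N).
apply: runs_weaken (runs_for (k := (2 ^ i)%N) (T := 2) (I := J) _ _ _ _ _) => //.
- by rewrite !ltnS leq_mul2r /= leq_exp2l // ltnW.
- move=> s2 [[fi2 _] [Cl Ch]]; apply: runs_wp; split.
  + by rewrite /= /upd /= fi2 //= S1 addnn expnS mul2n.
  + by rewrite /= /upd /= fi2.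
  + move=> x; rewrite expnS mul2n -addnn => xlt; rewrite /= /upd /=.
    case: (ltnP x (2 ^ i)) => [xi|ix]; first by rewrite Cl // clearS_low.
    by rewrite -(subnKC ix) Ch //; lia.
- by move=> s2 [fi2 _] /=; rewrite fi2.
- move=> j s2 ji [fi2 _] vj [Cl Ch]; apply: runs_wp.
  have S2 : icell s2 vS 0 = (2 ^ i)%N by rewrite fi2.
  have I2 : icell s2 vI 0 = i by rewrite fi2.
  have Q2 : icell s2 vQ 0 = (i.+1 %% L)%N by rewrite fi2.
  have Db : ~~ ((g < i + 1) && (0 < icell s2 vQ 0))%N = D i.
    by rewrite Q2 addn1 ltnS /D /forbidden negb_and -ltnNge -eqn0Ngt.
  have top x : (x < 2 ^ i)%N -> clear D i.+1 (2 ^ i + x)%N = ~~ D i && clear D i x.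
    exact: clearS_top.
  rewrite /= I2 Db; case Di : (D i) => /=; split=> x xj /=; rewrite /upd /= S2 vj.
  + by rewrite ifN ?Cl //; lia.
  + case: eqP => [e|ne]; first by rewrite top ?Di //; lia.
    by apply: Ch; lia.
  + by rewrite ifN ?Cl //; lia.
  + case: eqP => [e|ne]; last by apply: Ch; lia.
    rewrite top ?Di /=; last by lia.
    by rewrite Cl //; congr (nat_of_bool (clear _ _ _)); lia.
Qed.

Lemma c_zero_ok {R : realType} a e k (s : memory R) :
    (forall s', frame (c_zero a e) s s' -> ieval s' e = k) ->
  runs (c_zero a e) s (k * 3).+2 (fun s' => forall t, (t < k)%N -> rcell s' a t = 0).
Proof.
move=> ek.
pose I i (s' : memory R) := forall t, (t < i)%N -> rcell s' a t = 0.
apply: runs_weaken (runs_for (k := k) (T := 1) (I := I) _ _ _ _ _) => //.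
  by move=> s' [].
move=> i s' ik _ vi Ii; apply: runs_wp => t ti /=; rewrite /upd eqxx vi /=.
by case: eqP => // /eqP ne; apply: Ii; move: ti ne; lia.
Qed.

(** * The dynamic program for one shift and the loop over all shifts *)

Section MainLoop.
Context {R : realType} (n g L m : nat) (xs ys : nat -> nat) (ws : nat -> R).
Hypothesis g_gt0 : (0 < g)%N.
Hypothesis L_gt0 : (0 < L)%N.
Hypothesis xs_grid : forall v, (v < m)%N -> (0 < xs v <= n)%N.
Hypothesis ys_grid : forall v, (v < m)%N -> (0 < ys v <= n)%N.
Implicit Types s : memory R.

Local Notation W := (width g L).
Local Notation S := (2 ^ W)%N.
Local Notation N := (cells n g L).
Local Notation D := (forbidden g L).
Local Notation wt := (cell_weight n g L m xs ys ws).
Local Notation vpos := (vpos n g L xs ys).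
Local Notation vkept := (vkept g L xs).
Local Notation value := (value n g L m xs ys ws).

Let W_gt0 : (0 < W)%N. Proof. by rewrite muln_gt0 g_gt0. Qed.

(** The input and the tables prepared once. The shift loop writes to none of these arrays, so
    [env_frame] carries the record through it. *)
Record env s : Prop := Env {
  env_n : icell s 0 0 = n;
  env_m : icell s 0 1 = m;
  env_x : forall v, (v < m)%N -> icell s aX v = xs v;
  env_y : forall v, (v < m)%N -> icell s aY v = ys v;
  env_w : forall v, (v < m)%N -> rcell s rWeight v = ws v;
  env_L : icell s vL 0 = L;
  env_row : forall r, (r <= n + L)%N -> icell s aRow r = row_pos n g L r;
  env_rem : forall r, (r <= n + L)%N -> icell s aRem r = (r %% L)%N;
  env_col : forall y, (y <= n + g)%N -> icell s aCol y = (y * L)%N;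
  env_clear : forall x, (x < S)%N -> icell s aClear x = clear D W x;
  env_S : icell s vS 0 = S;
  env_N : icell s vN 0 = N;
  env_off : forall k, (k <= N)%N -> icell s aOff k = (k * S)%N }.

Lemma env_frame c s s' : frame c s s' ->
    all (fun a => a \notin iwritten c)
      [:: 0; aX; aY; vL; aRow; aRem; aCol; aClear; vS; vN; aOff]%N ->
    rWeight \notin rwritten c -> env s -> env s'.
Proof.
move=> [fi fr] /= /and5P[? ? ? ? /and5P[? ? ? ? /and4P[? ? ? _]]] ? [].
by split; intros; rewrite ?(fi, fr) //; auto.
Qed.

Lemma e_posE s sh v e : env s -> icell s vShift 0 = sh -> (sh < L)%N -> (v < m)%N ->
  ieval s e = v -> ieval s (e_pos e) = vpos sh v.
Proof.
move=> E es shL vm ev; have /andP[x0 xn] := xs_grid vm; have /andP[y0 yn] := ys_grid vm.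
rewrite /= ev es (env_x E) // (env_y E) // (env_row E) ?(env_col E) //; lia.
Qed.

Lemma b_keptE s sh v e : env s -> icell s vShift 0 = sh -> (sh < L)%N -> (v < m)%N ->
  ieval s e = v -> beval s (b_kept g e) = vkept sh v.
Proof.
move=> E es shL vm ev; have /andP[x0 xn] := xs_grid vm.
rewrite /= ev es (env_x E) // (env_rem E) //; lia.
Qed.

Lemma c_fill_ok sh s : env s -> icell s vShift 0 = sh -> (sh < L)%N ->
    (forall t, (t < N)%N -> rcell s rCell t = 0) ->
  runs (c_fill g) s (m * 4).+2
    (fun s' => forall t, (t < N)%N -> rcell s' rCell t = wt sh t).
Proof.
move=> E es shL z.
pose I i s' := forall t, (t < N)%N -> rcell s' rCell t =
  \sum_(0 <= v < i) if vkept sh v && (vpos sh v == t) then ws v else 0.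
apply: runs_weaken (runs_for (k := m) (T := 2) (I := I) _ _ _ _ _) => //.
- by move=> s' [].
- by move=> s' fr /=; apply: (env_m (env_frame fr _ _ E)).
- by move=> t tN; rewrite big_nil z.
move=> i s' im fr vi Ii; have E' : env s' by apply: env_frame fr _ _ E.
have es' : icell s' vShift 0 = sh by case: fr => fi _; rewrite fi.
have := b_keptE (e := var vI) E' es' shL im vi.
have := e_posE (e := var vI) E' es' shL im vi.
move=> /= pE kE; apply: runs_wp; rewrite /= kE; case: (boolP (vkept sh i)) => kv t tN.
  rewrite big_nat_recr //= kv /= pE vi (env_w E') // /upd eqxx /= (eq_sym t) -(Ii t tN).
  by case: eqP => [->|_] //; rewrite addr0.
by rewrite big_nat_recr //= (negbTE kv) addr0 Ii.
Qed.

Lemma c_double_ok e x s : env s -> ieval s e = x -> (x < S)%N ->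
  runs (c_double e) s 3
    (fun s' => frame (c_double e) s s' /\ icell s' vP 0 = shift0 W x).
Proof.
move=> E ex xS; apply: runs_frame; apply: runs_wp => /=.
rewrite /upd /= (env_S E) ex shift0E //.
by case: (_ <= _)%N.
Qed.

Lemma takeE s sh k x ek ex : env s ->
    (forall t, (t < N)%N -> rcell s rCell t = wt sh t) ->
    (forall y, (y < S)%N -> rcell s rDp (k * S + y) = dp W D (wt sh) k y) ->
    (k < N)%N -> (x < S)%N -> ieval s ek = k -> ieval s ex = x ->
    icell s vP 0 = shift0 W x ->
  [/\ beval s (b_take ek ex) = takes W D (wt sh) k x,
      reval s (e_skip ek) = dp W D (wt sh) k (shift0 W x) &
      reval s (e_take ek) = wt sh k + dp W D (wt sh) k (shift0 W x).+1].
Proof.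
move=> E wE dE kN xS eek eex eP; rewrite /= eek eex eP addn1.
rewrite (env_off E) ?wE ?(env_clear E) ?dE ?shift0_lt ?shift1_lt //; last exact: ltnW.
by rewrite /takes; case: (clear _ _ _).
Qed.

Lemma c_dp_ok sh s : env s -> (forall t, (t < N)%N -> rcell s rCell t = wt sh t) ->
    (forall x, (x < S)%N -> rcell s rDp x = 0) ->
  runs c_dp s (N * (S * 7).+4).+2 (fun s' => forall k x, (k <= N)%N -> (x < S)%N ->
    rcell s' rDp (k * S + x) = dp W D (wt sh) k x).
Proof.
move=> E wE z.
pose I i s' := forall k x, (k <= i)%N -> (x < S)%N ->
    rcell s' rDp (k * S + x) = dp W D (wt sh) k x.
apply: runs_weaken (runs_for (k := N) (T := (S * 7).+2) (I := I) _ _ _ _ _) => //.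
- by move=> s' [].
- by move=> s' fr /=; apply: (env_N (env_frame fr _ _ E)).
- by move=> k x; rewrite leqn0 => /eqP -> xS; rewrite mul0n z.
move=> k s' kN fr vk Ik; have E' : env s' by apply: env_frame fr _ _ E.
have wE' t : (t < N)%N -> rcell s' rCell t = wt sh t.
  by case: fr => _ f /wE <-; rewrite f.
(* Row [k + 1] is filled entry by entry, reading only row [k]. *)
pose J j s1 := I k s1 /\ forall x, (x < j)%N ->
    rcell s1 rDp (k.+1 * S + x) = dp W D (wt sh) k.+1 x.
apply: runs_weaken (runs_for (k := S) (T := 5) (I := J) _ _ _ _ _) => //.
- move=> s1 [_ [I1 J1]] k' x; rewrite leq_eqVlt => /predU1P[-> xS|]; first exact: J1.
  by rewrite ltnS => /I1 h /h.
- by move=> s1 fr1 /=; apply: (env_S (env_frame fr1 _ _ E')).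
move=> j s1 jS fr1 vj [I1 J1]; have E1 : env s1 by apply: env_frame fr1 _ _ E'.
apply: (@runs_seq _ _ _ _ 3 2).
apply: runs_weaken (c_double_ok (e := var vJ) E1 vj jS) => // s2 [fr2 P2].
have E2 : env s2 by apply: env_frame fr2 _ _ E1.
have vk2 : icell s2 vK 0 = k.
  by case: fr2 => f2 _; rewrite f2 //; case: fr1 => f1 _; rewrite f1.
have vj2 : icell s2 vJ 0 = j by case: fr2 => f2 _; rewrite f2.
have r2 t : rcell s2 rDp t = rcell s1 rDp t by case: fr2 => _ f2; rewrite f2.
have wE2 t : (t < N)%N -> rcell s2 rCell t = wt sh t.
  by move=> /wE' <-; case: fr2 => _ f2; rewrite f2 //; case: fr1 => _ f1; rewrite f1.
have [bE sE tE] := takeE (ek := var vK) (ex := var vJ) E2 wE2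
  (fun y yS => etrans (r2 _) (I1 k y (leqnn k) yS)) kN jS vk2 vj2 P2.
have cellE Q v : (forall s3, (forall t, rcell s3 rDp t =
      if t == (k.+1 * S + j)%N then v else rcell s1 rDp t) -> Q s3) ->
    Q (Memory (icell s2)
        (upd (rcell s2) rDp (ieval s2 (IAdd (IGet aOff (succ (var vK))) (var vJ))) v)).
  move=> H; apply: H => t; rewrite /= /upd eqxx /= vk2 vj2 addn1 (env_off E2) // r2.
  by [].
have fin s3 : (forall t, rcell s3 rDp t =
    if t == (k.+1 * S + j)%N then dp W D (wt sh) k.+1 j else rcell s1 rDp t) ->
    J j.+1 s3.
  move=> h; split=> [k' x k'k xS|x xj]; rewrite h.
    rewrite ifN ?I1 //; apply/eqP.
    (* Entries of rows up to [k] lie below [k.+1 * S], so the entry just written is none of them. *)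
    have : ((k' * S + S) <= k.+1 * S)%N by rewrite addnC -mulSn leq_mul2r ltnS k'k orbT.
    lia.
  by case: eqP => [/addnI -> //|ne]; apply: J1; lia.
move: bE sE tE => /= bE sE tE; apply: runs_wp; rewrite /= bE.
case tk: (takes _ _ _ _ _).
  by rewrite tE; apply: cellE => s3 h; apply: fin => t; rewrite h dpS tk.
by rewrite sE; apply: cellE => s3 h; apply: fin => t; rewrite h dpS tk.
Qed.

Lemma c_trace_ok sh s : env s -> (forall t, (t < N)%N -> rcell s rCell t = wt sh t) ->
    (forall k x, (k <= N)%N -> (x < S)%N ->
      rcell s rDp (k * S + x) = dp W D (wt sh) k x) ->
  runs c_trace s (N * 9 + 3) (fun s' => forall k, (k < N)%N ->
    icell s' aChoice k = choice W N D (wt sh) k).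
Proof.
move=> E wE dE; have -> : (N * 9 + 3 = 1 + (N * 9).+2)%N by lia.
apply: runs_seq; apply: runs_weaken (runs_frame (@runs_wp _ _ _
  (fun s' => icell s' vT 0 = 0%N) _)) => // s0 [fr0 vT0].
have {}E : env s0 by apply: env_frame fr0 _ _ E.
have {}wE t : (t < N)%N -> rcell s0 rCell t = wt sh t.
  by case: fr0 => _ f /wE <-; rewrite f.
have {}dE k x : (k <= N)%N -> (x < S)%N ->
    rcell s0 rDp (k * S + x) = dp W D (wt sh) k x.
  by move=> h1 h2; case: fr0 => _ f; rewrite f // dE.
(* After [i] rounds [vT] is the current window and the decisions on the top [i] positions are
   recorded. *)
pose I i s' := icell s' vT 0 = trace W N D (wt sh) i /\
  forall k, (N - i <= k < N)%N -> icell s' aChoice k = choice W N D (wt sh) k.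
apply: runs_weaken (runs_for (k := N) (T := 7) (I := I) _ _ _ _ _) => //.
- by move=> s' [_ [_ h]] k kN; apply: h; lia.
- by move=> s' fr /=; apply: (env_N (env_frame fr _ _ E)).
- by split=> // k; lia.
move=> i s1 iN fr1 vi [T1 C1]; have E1 : env s1 by apply: env_frame fr1 _ _ E.
apply: (@runs_seq _ _ _ _ 1 6).
apply: runs_weaken (runs_frame (@runs_wp _ _ _
  (fun s' => icell s' vC 0 = (N - i.+1)%N) _)) => //; last first.
  by rewrite /= /upd /= vi (env_N E1) addn1.
move=> s2 [fr2 C2]; have E2 : env s2 by apply: env_frame fr2 _ _ E1.
have T2 : icell s2 vT 0 = trace W N D (wt sh) i by case: fr2 => f _; rewrite f.
have tS : (trace W N D (wt sh) i < S)%N by rewrite traceE ?window_lt // ltnW.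
apply: (@runs_seq _ _ _ _ 3 3).
apply: runs_weaken (c_double_ok (e := var vT) E2 T2 tS) => // s3 [fr3 P3].
have E3 : env s3 by apply: env_frame fr3 _ _ E2.
have T3 : icell s3 vT 0 = trace W N D (wt sh) i by case: fr3 => f _; rewrite f.
have C3 : icell s3 vC 0 = (N - i.+1)%N by case: fr3 => f _; rewrite f.
have w3 t : (t < N)%N -> rcell s3 rCell t = wt sh t.
  case: fr3 => _ f3; case: fr2 => _ f2; case: fr1 => _ f1 /wE <-.
  by rewrite f3 // f2 // f1.
have kN : (N - i.+1 < N)%N by lia.
have d3 y : (y < S)%N ->
    rcell s3 rDp ((N - i.+1) * S + y) = dp W D (wt sh) (N - i.+1) y.
  move=> yS; rewrite -(dE _ y (ltnW kN) yS).
  by case: fr3 => _ f3; case: fr2 => _ f2; case: fr1 => _ f1; rewrite f3 // f2 // f1.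
have [bE _ _] := takeE (ek := var vC) (ex := var vT) E3 w3 d3 kN tS C3 T3 P3.
have chE : choice W N D (wt sh) (N - i.+1) =
    takes W D (wt sh) (N - i.+1) (trace W N D (wt sh) i).
  by rewrite /choice; congr (takes _ _ _ _ (trace _ _ _ _ _)); lia.
have ch3 k : icell s3 aChoice k = icell s1 aChoice k.
  by case: fr3 => f3 _; case: fr2 => f2 _; rewrite f3 // f2.
move: bE => /= bE; apply: runs_wp; rewrite /= bE.
case tk: (takes _ _ _ _ _);
  (split=> [|k]; rewrite /= /upd /=; first by rewrite P3 tk ?addn1 ?addn0);
  rewrite C3 => kr; (case: eqP => [->|ne]; first by rewrite chE tk);
  by rewrite ch3 C1 //; lia.
Qed.

Lemma c_output_ok sh s : env s -> icell s vShift 0 = sh -> (sh < L)%N ->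
    (forall k, (k < N)%N -> icell s aChoice k = choice W N D (wt sh) k) ->
  runs (c_output g) s (m * 4).+2 (fun s' => forall v, (v < m)%N ->
    icell s' aOut v = selected n g L m xs ys ws sh v).
Proof.
move=> E es shL cE.
pose I i s' := forall v, (v < i)%N -> icell s' aOut v = selected n g L m xs ys ws sh v.
apply: runs_weaken (runs_for (k := m) (T := 2) (I := I) _ _ _ _ _) => //.
- by move=> s' [].
- by move=> s' fr /=; apply: (env_m (env_frame fr _ _ E)).
move=> i s' im fr vi Ii; have E' : env s' by apply: env_frame fr _ _ E.
have es' : icell s' vShift 0 = sh by case: fr => fi _; rewrite fi.
have := b_keptE (e := var vI) E' es' shL im vi.
have := e_posE (e := var vI) E' es' shL im vi.
move=> /= pE kE; apply: runs_wp; rewrite /= kE; case: (boolP (vkept sh i)) => kv v vi1.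
  rewrite /= pE /upd eqxx /= vi; case: eqP => [->|ne]; last by apply: Ii; lia.
  case: fr => fi _; rewrite fi // cE /selected ?kv //.
  exact: (vpos_lt g_gt0 L_gt0 xs_grid ys_grid shL im).
rewrite /= /upd eqxx /= vi; case: eqP => [->|ne]; last by apply: Ii; lia.
by rewrite /selected (negbTE kv).
Qed.

Definition out s (v : nat) : bool := icell s aOut v != 0%N.

(** An inequality between the recorded value and the weight of the output is enough for a lower
    bound on that weight. *)
Record best_upto sh s : Prop := BestUpto {
  best_indep : indep g m xs ys (out s);
  best_mass : rcell s rBest 0 <= mass m ws (out s);
  best_max : forall sh', (sh' < sh)%N -> value sh' <= rcell s rBest 0 }.

Lemma indep_ext (o o' : nat -> bool) : (forall v, (v < m)%N -> o v = o' v) ->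
  indep g m xs ys o -> indep g m xs ys o'.
Proof. by move=> e io u v um vm; rewrite -!e //; apply: io. Qed.

Lemma mass_ext (o o' : nat -> bool) : (forall v, (v < m)%N -> o v = o' v) ->
  mass m ws o = mass m ws o'.
Proof.
by move=> e; rewrite /mass big_nat [RHS]big_nat; apply: eq_bigr => v /andP[_ /e ->].
Qed.

Lemma best_upto_frame c sh s s' : frame c s s' ->
  aOut \notin iwritten c -> rBest \notin rwritten c ->
  best_upto sh s -> best_upto sh s'.
Proof.
move=> [fi fr] ni nr [i t x].
have e v : (v < m)%N -> out s v = out s' v by rewrite /out fi.
split; first exact: indep_ext e i.
  by rewrite fr // -(mass_ext e).
by move=> sh' /x; rewrite fr.
Qed.

Definition update_time : nat := (1 + ((N * 9 + 3) + (m * 4).+2)).+1.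

Lemma c_update_ok sh s : env s -> icell s vShift 0 = sh -> (sh < L)%N ->
    best_upto sh s ->
    (forall t, (t < N)%N -> rcell s rCell t = wt sh t) ->
    (forall k x, (k <= N)%N -> (x < S)%N ->
      rcell s rDp (k * S + x) = dp W D (wt sh) k x) ->
  runs (c_update g) s update_time (best_upto sh.+1).
Proof.
move=> E es shL B wE dE; apply: runs_if.
have vE : rcell s rDp (ieval s (IGet aOff (var vN))) = value sh.
  have := dE N 0%N (leqnn N); rewrite expn_gt0 addn0 => /(_ isT) vE.
  by rewrite /= (env_N E) (env_off E).
have /= -> : beval s (RLe (RGet rBest (INum 0)) (RGet rDp (IGet aOff (var vN)))) =
    (rcell s rBest 0 <= value sh) by rewrite -vE.
case: leP => le; last first.
  apply: (@runs_weaken _ _ _ 1 _ (best_upto sh.+1)) => //; apply: runs_wp.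
  case: B => i t x; split=> // sh'; rewrite ltnS leq_eqVlt => /predU1P[->|/x //].
  exact: ltW.
apply: runs_seq; apply: runs_weaken (runs_frame (@runs_wp _ _ _
  (fun s' => rcell s' rBest 0 = value sh) _)) => //.
move=> s1 [fr1 b1]; apply: runs_seq.
have E1 : env s1 by apply: env_frame fr1 _ _ E.
have wE1 t : (t < N)%N -> rcell s1 rCell t = wt sh t.
  by case: fr1 => _ f /wE <-; rewrite f.
have dE1 k x : (k <= N)%N -> (x < S)%N -> rcell s1 rDp (k * S + x) = dp W D (wt sh) k x.
  by move=> h1 h2; case: fr1 => _ f; rewrite f // dE.
apply: runs_weaken (runs_frame (c_trace_ok E1 wE1 dE1)) => // s2 [fr2 c2].
have E2 : env s2 by apply: env_frame fr2 _ _ E1.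
have es2 : icell s2 vShift 0 = sh.
  by case: fr2 => f2 _; case: fr1 => f1 _; rewrite f2 // f1.
apply: runs_weaken (runs_frame (c_output_ok E2 es2 shL c2)) => //.
move=> s3 [fr3 o3].
have e v : (v < m)%N -> selected n g L m xs ys ws sh v = out s3 v.
  by move=> vm; rewrite /out o3 // eqb0 negbK.
have b3 : rcell s3 rBest 0 = value sh.
  by case: fr3 => _ f3; case: fr2 => _ f2; rewrite f3 // f2.
split; rewrite ?b3.
- by apply: indep_ext e _; apply: selected_indep.
- by rewrite -(mass_ext e) selected_mass.
- move=> sh'; rewrite ltnS leq_eqVlt => /predU1P[-> //|h].
  by apply: le_trans le; apply: best_max h.
Qed.

Definition shift_time : nat :=
  (N * 3).+2 + ((m * 4).+2 + ((S * 3).+2 + ((N * (S * 7).+4).+2 + update_time))).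

Lemma c_shift_ok sh s : env s -> icell s vShift 0 = sh -> (sh < L)%N ->
  best_upto sh s -> runs (c_shift g) s shift_time (best_upto sh.+1).
Proof.
move=> E es shL B; apply: runs_seq.
apply: runs_weaken (runs_frame
  (c_zero_ok (a := rCell) (e := var vN) (k := N) (s := s) _)) => //; last first.
  by move=> s' fr; apply: (env_N (env_frame fr _ _ E)).
move=> s1 [fr1 z1]; have E1 : env s1 by apply: env_frame fr1 _ _ E.
have es1 : icell s1 vShift 0 = sh by case: fr1 => f1 _; rewrite f1.
have B1 : best_upto sh s1 by apply: best_upto_frame fr1 _ _ B.
apply: runs_seq; apply: runs_weaken (runs_frame (c_fill_ok E1 es1 shL z1)) => //.
move=> s2 [fr2 w2]; have E2 : env s2 by apply: env_frame fr2 _ _ E1.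
have es2 : icell s2 vShift 0 = sh by case: fr2 => f2 _; rewrite f2.
have B2 : best_upto sh s2 by apply: best_upto_frame fr2 _ _ B1.
apply: runs_seq.
apply: runs_weaken (runs_frame
  (c_zero_ok (a := rDp) (e := var vS) (k := S) (s := s2) _)) => //; last first.
  by move=> s' fr; apply: (env_S (env_frame fr _ _ E2)).
move=> s3 [fr3 z3]; have E3 : env s3 by apply: env_frame fr3 _ _ E2.
have es3 : icell s3 vShift 0 = sh by case: fr3 => f3 _; rewrite f3.
have B3 : best_upto sh s3 by apply: best_upto_frame fr3 _ _ B2.
have w3 t : (t < N)%N -> rcell s3 rCell t = wt sh t.
  by case: fr3 => _ f /w2 <-; rewrite f.
apply: runs_seq; apply: runs_weaken (runs_frame (c_dp_ok E3 w3 z3)) => //.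
move=> s4 [fr4 d4]; have E4 : env s4 by apply: env_frame fr4 _ _ E3.
have es4 : icell s4 vShift 0 = sh by case: fr4 => f4 _; rewrite f4.
have B4 : best_upto sh s4 by apply: best_upto_frame fr4 _ _ B3.
have w4 t : (t < N)%N -> rcell s4 rCell t = wt sh t.
  by case: fr4 => _ f /w3 <-; rewrite f.
exact: c_update_ok.
Qed.

Definition prepare_time K : nat :=
  (1 + (K * 3).+1) + (((n + g) * 3 + 3) + (((n + L) * 5 + 4) +
  (1 + ((3 + (W * (3 + ((S * 4).+2 + 1)).+2).+2) + (N * 3 + 3))))).

Lemma c_prepare_ok K (eps : R) s : L = (g * K.+1)%N ->
    rcell s rAcc 0 = 0 -> rcell s 0 0 = eps ->
    (forall k, (k < K)%N -> k%:R * eps < 1) -> 1 <= K%:R * eps ->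
    icell s 0 0 = n -> icell s 0 1 = m ->
    (forall v, (v < m)%N -> icell s aX v = xs v) ->
    (forall v, (v < m)%N -> icell s aY v = ys v) ->
    (forall v, (v < m)%N -> rcell s rWeight v = ws v) ->
  runs (c_prepare g) s (prepare_time K) env.
Proof.
move=> LK acc0 eps0 Klt Kle sn sm sx sy sw.
apply: runs_seq; apply: runs_weaken (runs_frame
  (c_period_ok g acc0 eps0 Klt Kle)) => //.
move=> s1 [[f1 r1]]; rewrite -LK => L1.
apply: runs_seq; apply: runs_weaken (runs_frame
  (c_multiples_ok (k := (n + g)%N) _ _ _ L1 _)) => //; last first.
  by move=> s' [f _] /=; rewrite f // f1 // sn.
move=> s2 [[f2 r2] c2].
have L2 : icell s2 vL 0 = L by rewrite f2.
have n2 : icell s2 0 0 = n by rewrite f2 // f1.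
apply: runs_seq; apply: runs_weaken (runs_frame
  (c_rows_ok L_gt0 _ n2 L2 (c2 _ (leqnn _)))) => //; last first.
  by rewrite addn_gt0 g_gt0 orbT.
move=> s3 [[f3 r3] w3].
have L3 : icell s3 vL 0 = L by rewrite f3.
have n3 : icell s3 0 0 = n by rewrite f3.
have c3 y : (y <= n + g)%N -> icell s3 aCol y = (y * L)%N by move=> /c2 <-; rewrite f3.
apply: runs_seq; apply: runs_weaken (runs_frame
  (@runs_wp _ _ _ (fun s' => icell s' vN 0 = N) _)) => //; last first.
  rewrite /= /upd /= n3 L3 c3 ?leq_addr //.
  by have [-> _] := w3 _ (leqnn (n + L)%N).
move=> s4 [[f4 r4] N4].
have L4 : icell s4 vL 0 = L by rewrite f4.
apply: runs_seq; apply: runs_weaken (runs_frame (c_clear_ok g L_gt0 L4)) => //.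
move=> s5 [[f5 r5] [S5 C5]].
have N5 : icell s5 vN 0 = N by rewrite f5.
apply: runs_weaken (runs_frame (c_multiples_ok (k := N) _ _ _ S5 _)) => //; last first.
  by move=> s' [f _] /=; rewrite f.
move=> s6 [[f6 r6] Q6]; split=> //.
- by rewrite f6 // f5 // f4 // f3.
- by rewrite f6 // f5 // f4 // f3 // f2 // f1.
- by move=> v /sx <-; rewrite f6 // f5 // f4 // f3 // f2 // f1.
- by move=> v /sy <-; rewrite f6 // f5 // f4 // f3 // f2 // f1.
- by move=> v /sw <-; rewrite r6 // r5 // r4 // r3 // r2 // r1.
- by rewrite f6 // f5.
- by move=> r /w3[<- _]; rewrite f6 // f5 // f4.
- by move=> r /w3[_ <-]; rewrite f6 // f5 // f4.
- by move=> y /c3 <-; rewrite f6 // f5 // f4.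
- by move=> x /C5 <-; rewrite f6.
- by rewrite f6.
- by rewrite f6.
Qed.

Definition scheme_time K : nat := (prepare_time K + (L * shift_time.+2).+2)%N.

Lemma scheme_ok K (eps : R) s : L = (g * K.+1)%N ->
    rcell s rAcc 0 = 0 -> rcell s 0 0 = eps ->
    (forall k, (k < K)%N -> k%:R * eps < 1) -> 1 <= K%:R * eps ->
    icell s 0 0 = n -> icell s 0 1 = m ->
    (forall v, (v < m)%N -> icell s aX v = xs v) ->
    (forall v, (v < m)%N -> icell s aY v = ys v) ->
    (forall v, (v < m)%N -> rcell s rWeight v = ws v) ->
    (forall v, (v < m)%N -> icell s aOut v = 0%N) -> rcell s rBest 0 = 0 ->
  runs (scheme g) s (scheme_time K) (best_upto L).
Proof.
move=> LK acc0 eps0 Klt Kle sn sm sx sy sw so sb; apply: runs_seq.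
apply: runs_weaken (runs_frame
  (c_prepare_ok LK acc0 eps0 Klt Kle sn sm sx sy sw)) => //.
move=> s1 [fr1 E1].
(* Before the first shift the output is empty and the recorded value is 0. *)
have B1 : best_upto 0 s1.
  apply: best_upto_frame fr1 _ _ _ => //.
  have o0 v : (v < m)%N -> out s v = false by move=> /so e; rewrite /out e.
  split=> //; first by move=> u v /o0 ->.
  rewrite sb /mass big_nat big1 // => v /andP[_ /o0 ->] //.
apply: runs_weaken (runs_for (k := L) (T := shift_time)
  (I := best_upto) _ _ _ _ _) => //.
- by move=> s' [].
- by move=> s' fr /=; apply: (env_L (env_frame fr _ _ E1)).
- by move=> i s' x [].
- move=> sh s' shL fr es B; apply: c_shift_ok => //.
  exact: env_frame fr _ _ E1.
Qed.

End MainLoop.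

(** * Time bound *)

(** [B] is chosen so that [B ^ K.+1] equals [2 ^ L * 2 ^ L * 2 ^ (g * L)]: the last factor counts
    the windows, the other two absorb the number of shifts and the factor [1 + L] in the number of
    cells. *)
Lemma scheme_time_le n g K m L B :
    L = (g * K.+1)%N -> B = (2 ^ (g.+2 * g))%N ->
    (0 < n)%N -> (0 < g)%N -> (m <= n ^ 2)%N ->
  (scheme_time n g L m K <= 100 * (2 + g) * B * n ^ 2 * B ^ K)%N.
Proof.
move=> LE BE n0 g0 mn; have L0 : (0 < L)%N by rewrite LE muln_gt0 g0.
have KL : (K < L)%N by rewrite LE leq_pmull.
pose E := ((1 + L) * (2 + g))%N.
have cE : (cells n g L <= n ^ 2 * E)%N.
  apply: leq_trans (@cells_le n g L g0 L0 n0) _.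
  by rewrite leq_mul2l /E !mulnDr !mulnDl; apply/orP; right; lia.
have W_E : (width g L <= E)%N by rewrite /width /E !mulnDr !mulnDl; lia.
rewrite /scheme_time /prepare_time /shift_time /update_time.
move: (cells n g L) cE => N cE; set S := (2 ^ width g L)%N.
have S0 : (0 < S)%N by rewrite expn_gt0.
(* The yardstick: [P] bounds the size of the table, and the terms of the running time are compared
   with it. *)
pose P := (n ^ 2 * E * S)%N.
have n2 : (0 < n ^ 2)%N by rewrite expn_gt0 n0.
have nn2 : (n <= n ^ 2)%N by rewrite expnS expn1 leq_pmulr.
have E0 : (0 < E)%N by rewrite /E muln_gt0.
have EP : (E <= P)%N by rewrite /P mulnAC leq_pmull // muln_gt0 n2.
have NP : (N * S <= P)%N by rewrite /P leq_mul2r cE orbT.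
have N_P : (N <= P)%N by apply: leq_trans NP; rewrite leq_pmulr.
have n2P : (n ^ 2 <= P)%N by rewrite /P -mulnA leq_pmulr // muln_gt0 E0.
have SP : (S <= P)%N by rewrite /P leq_pmull // muln_gt0 n2.
have WP : (width g L * S <= P)%N.
  by rewrite /P leq_mul2r; apply/orP; right; apply: leq_trans W_E _; rewrite leq_pmull.
have W_P : (width g L <= P)%N by apply: leq_trans WP; rewrite leq_pmulr.
have gE : (g + L <= E)%N by rewrite /E !mulnDr !mulnDl; lia.
have shift : ((N * 3).+2 + ((m * 4).+2 + ((S * 3).+2 + ((N * (S * 7).+4).+2 +
    (1 + (N * 9 + 3 + (m * 4).+2)).+1))) <= 60 * P)%N.
  have -> : (N * (S * 7).+4 = (N * S) * 7 + N * 4)%N.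
    by rewrite -mulnA -mulnDr; congr (_ * _)%N; lia.
  lia.
have clr : (width g L * (3 + ((S * 4).+2 + 1)).+2 =
    (width g L * S) * 4 + width g L * 8)%N.
  by rewrite -mulnA -mulnDr; congr (_ * _)%N; lia.
rewrite clr.
have : (L * (60 * P).+2 <= L * (62 * P))%N by rewrite leq_mul2l; apply/orP; right; lia.
move: shift; set T := (_ + (_ + _))%N => shift loop.
have {}shift : (L * T.+2 <= L * (62 * P))%N.
  by apply: leq_trans loop; rewrite leq_mul2l !ltnS shift orbT.
apply: (@leq_trans (100 * ((1 + L) * P))).
  have -> : (100 * ((1 + L) * P) = 100 * P + 38 * (L * P) + L * (62 * P))%N by lia.
  lia.
have LB : (1 + L <= 2 ^ L)%N by rewrite add1n ltn_expl.
have -> : (100 * ((1 + L) * P) = 100 * (2 + g) * n ^ 2 * ((1 + L) * (1 + L) * S))%N.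
  by rewrite /P /E; lia.
have -> : (100 * (2 + g) * B * n ^ 2 * B ^ K = 100 * (2 + g) * n ^ 2 * B ^ K.+1)%N.
  by rewrite [(B ^ K.+1)%N]expnS; move: (n ^ 2)%N (B ^ K)%N => a b; lia.
rewrite leq_mul2l; apply/orP; right.
have -> : (B ^ K.+1 = 2 ^ L * 2 ^ L * S)%N.
  by rewrite BE /S -!expnM -!expnD /width LE; congr (2 ^ _)%N; lia.
by rewrite leq_mul2r leq_mul ?orbT.
Qed.

(* In logarithms: [x * ln (B / x) <= B]. *)
Lemma exp_le_self_power {R : realType} (B x : R) : 0 < B -> 0 < x ->
  powR B x <= expR B * powR x x.
Proof.
move=> B0 x0; rewrite /powR !gt_eqF // -expRD ler_expR.
have -> : B = B / x * x by rewrite divfK // gt_eqF.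
have Bx : 0 < B / x by rewrite divr_gt0.
rewrite lnM ?posrE // mulrDr lerD2r mulrC ler_pM2r //.
have := @le_ln1Dx _ (B / x - 1); rewrite [1 + _]addrC subrK => h.
by apply: le_trans (h _) _; lra.
Qed.

(** Minimality gives [(K - 1) * eps < 1], hence the upper bound on [K] for the running time;
    [1 <= K * eps] serves the approximation. *)
Lemma least_multiple {R : realType} (eps : R) : 0 < eps ->
  exists K : nat, [/\ forall k, (k < K)%N -> k%:R * eps < 1, 1 <= K%:R * eps,
    (0 < K)%N & K%:R <= 1 / eps + 1].
Proof.
move=> e0; have ex : exists k : nat, 1 <= k%:R * eps.
  exists (Num.truncn (1 / eps)).+1; rewrite -ler_pdivrMr //; apply: ltW.
  exact: truncnS_gt.
case: (ex_minnP ex) => K Kle Kmin; exists K.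
have below k : (k < K)%N -> k%:R * eps < 1.
  by move=> kK; rewrite ltNge; apply/negP => /Kmin; rewrite leqNgt kK.
have K0 : (0 < K)%N by case: (K) Kle => //; rewrite mul0r ler10.
split=> //; rewrite -lerBlDr ler_pdivlMr // -(natrB _ K0) subn1; apply: ltW.
by apply: below; rewrite prednK.
Qed.

(** * From vertices to their ranks in the input arrays *)

Section Instance.
Context {R : realType} (n omega : nat) (G : wgraph R) (f : vertex G -> nat * nat).
Hypothesis emb : LoS_embedding n omega f.

Local Notation m := #|vertex G|.
Local Notation xs := (nth 0%N [seq (f v).1 | v <- enum (vertex G)]).
Local Notation ys := (nth 0%N [seq (f v).2 | v <- enum (vertex G)]).
Local Notation ws := (nth (0 : R) [seq weight v | v <- enum (vertex G)]).

Lemma nth_rank (T : Type) (x0 : T) (h : vertex G -> T) v :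
  nth x0 [seq h u | u <- enum (vertex G)] (enum_rank v) = h v.
Proof. by rewrite (nth_map v) ?nth_enum_rank // -cardE ltn_ord. Qed.

Lemma rank_onto i : (i < m)%N -> exists v : vertex G, i = enum_rank v.
Proof.
by move=> im; exists (enum_val (Ordinal im)); rewrite enum_valK.
Qed.

(** For the time bound: loops over the vertices cost no more than a pass over the grid. *)
Lemma embedding_card : (m <= n ^ 2)%N.
Proof.
have [finj fgrid _] := emb.
have -> : m = size [seq f v | v <- enum (vertex G)] by rewrite size_map cardE.
have -> : (n ^ 2 = size [seq (x, y) | x <- iota 1 n, y <- iota 1 n])%N.
  by rewrite size_allpairs !size_iota.
apply: uniq_leq_size; first by rewrite map_inj_uniq ?enum_uniq.
move=> _ /mapP[v _ ->]; have /andP[] := fgrid v; case: (f v) => x y /= hx hy.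
by apply/allpairsP; exists (x, y); split; rewrite //= mem_iota add1n ltnS.
Qed.

Lemma mass_vertices o :
  mass m ws o = \sum_(v : vertex G | o (enum_rank v)) weight v.
Proof.
rewrite /mass big_mkord (reindex _ (onW_bij _ (@enum_rank_bij (vertex G)))) /=.
by rewrite -big_mkcond; apply: eq_bigr => v _; rewrite nth_rank.
Qed.

Lemma near_edge (u v : vertex G) : (0 < omega)%N ->
  near omega.-1 xs ys (enum_rank u) (enum_rank v) = edge u v.
Proof.
have [_ _ ->] := emb => o0; rewrite /near !nth_rank -!surjective_pairing.
by rewrite -ltnS prednK.
Qed.

(** Averaging gives [K * set_weight S <= K.+1 * b] for every independent [S], and [1 <= K * eps]
    bounds [K.+1] by [K * (1 + eps)]. *)
Lemma scheme_approximates eps K : (1 < omega)%N -> 0 < eps ->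
    (forall k, (k < K)%N -> k%:R * eps < 1) -> 1 <= K%:R * eps ->
  runs (scheme omega.-1) (input_memory n eps f)
    (scheme_time n omega.-1 (omega.-1 * K.+1) m K)
    (fun s => mis_approx eps (output_set G s)).
Proof.
move=> o1 e0 Klt Kle; set g := omega.-1; set L := (g * K.+1)%N.
have g0 : (0 < g)%N by rewrite /g; lia.
have L0 : (0 < L)%N by rewrite muln_gt0 g0.
have [_ fgrid _] := emb.
have xg i : (i < m)%N -> (0 < xs i <= n)%N.
  by move=> /rank_onto[v ->]; rewrite nth_rank; case/andP: (fgrid v).
have yg i : (i < m)%N -> (0 < ys i <= n)%N.
  by move=> /rank_onto[v ->]; rewrite nth_rank; case/andP: (fgrid v).
have wg i : (i < m)%N -> 0 <= ws i.
  by move=> /rank_onto[v ->]; rewrite nth_rank; apply/ltW/weight_gt0.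
apply: runs_weaken (@scheme_ok R n g L m xs ys ws g0 L0 xg yg K eps _
  _ _ _ _ _ _ _ _ _ _ _ _) => //.
move=> s [oi ot ox].
set b := rcell s rBest 0 in ot ox.
have outE v : (v \in output_set G s) = out s (enum_rank v) by rewrite inE.
have wS : set_weight (output_set G s) = mass m ws (out s).
  by rewrite mass_vertices; apply: eq_bigl => v; rewrite outE.
have key (S : {set vertex G}) : independent S -> set_weight S <= (1 + eps) * b.
  move=> /'forall_implyP iS.
  pose o i := [exists v in S, enum_rank v == i :> nat].
  have oE v : o (enum_rank v) = (v \in S).
    apply/existsP/idP => [[u /andP[uS /eqP /val_inj /enum_rank_inj <-]] //|vS].
    by exists v; rewrite vS eqxx.
  have io : indep g m xs ys o.
    move=> i j /rank_onto[u ->] /rank_onto[v ->].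
    rewrite !oE => uS vS.
    rewrite near_edge; last by lia.
    by have /'forall_implyP := iS _ uS; apply.
  have gL : (g <= L)%N by rewrite leq_pmulr.
  have := shift_average g0 L0 xg yg wg gL io ox.
  rewrite mass_vertices (eq_bigl _ _ oE) -/(set_weight S).
  (* The common factor [g] of [L - g] and [L] cancels from the average. *)
  have -> : (L - g = g * K)%N by rewrite /L mulnS addKn.
  rewrite /L !natrM -!mulrA ler_pM2l ?ltr0n // => avg.
  have w0 : 0 <= set_weight S by apply: sumr_ge0 => v _; apply/ltW/weight_gt0.
  have K0 : 0 < (K%:R : R).
    by rewrite ltr0n lt0n; apply: contraL Kle => /eqP ->; rewrite mul0r -ltNge.
  have b0 : 0 <= b.
    have : 0 <= K.+1%:R * b by apply: le_trans avg; rewrite mulr_ge0 // ltW.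
    by rewrite pmulr_rge0.
  rewrite -(ler_pM2l K0); apply: le_trans avg _.
  by rewrite mulrA ler_wpM2r // -natr1 mulrDr mulr1 lerD2l.
have e1 : 0 < 1 + eps by rewrite addr_gt0.
split.
  apply/forallP => u; apply/implyP; rewrite outE => ou.
  apply/forallP => v; apply/implyP; rewrite outE => ov.
  by rewrite -near_edge; [apply: oi | lia].
(* The default 0 of the maximum is a case of its own. *)
rewrite wS ler_pdivrMl //; apply: bigmax_le => [|S iS].
  rewrite mulr_ge0 ?(ltW e1) //; rewrite mass_vertices; apply: sumr_ge0 => v _.
  exact/ltW/weight_gt0.
by apply: le_trans (key S iS) _; rewrite ler_pM2l.
Qed.

End Instance.

Theorem theorem7 (R : realType) (omega : nat) (omega_gt2 : (2 < omega)%N) :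
  exists (P : cmd) (T : nat -> R -> R),
    mis_PTAS omega P T /\
    exists C : R, forall (n : nat) (eps : R), (0 < n)%N -> 0 < eps ->
      T n eps <= C * (n%:R ^+ 2
                      * powR omega%:R (omega%:R / eps - 1)
                      * powR (1 / eps) (1 / eps)).
Proof.
pose g := omega.-1; have [B BE] : {B : nat | B = 2 ^ (g.+2 * g)}%N by eexists.
have B_gt0 : (0 < B)%N by rewrite BE expn_gt0.
have B0 : 0 < (B%:R : R) by rewrite ltr0n.
(* The time bound [T] is the claimed one itself. In [C], one [B] is the factor of [scheme_time_le],
   the other pays for rounding [1 / eps] up to [K], [expR B] comes from [exp_le_self_power], and
   [omega] makes up for the [- 1] in the exponent. *)
pose C : R := (100 * (2 + g) * B * B)%:R * expR B%:R * omega%:R.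
pose T (n : nat) (eps : R) := C * (n%:R ^+ 2
  * powR omega%:R (omega%:R / eps - 1) * powR (1 / eps) (1 / eps)).
exists (scheme g), T; split; last by exists C.
split; last first.
  move=> eps _; exists (C * (powR omega%:R (omega%:R / eps - 1)
                             * powR (1 / eps) (1 / eps))), 2%N => n _.
  by rewrite /T le_eqVlt; apply/orP; left; apply/eqP; ring.
move=> n eps G f n0 e0 emb.
have [K [Klt Kle K0 K1]] := least_multiple e0.
have [|t [s [Ht le Hs]]] := scheme_approximates emb _ e0 Klt Kle; first by lia.
exists t, s; split=> //.
have g0 : (0 < g)%N by rewrite /g; lia.
have := leq_trans le (scheme_time_le (K := K) erefl BE n0 g0 (embedding_card emb)).
rewrite -(ler_nat R) => /le_trans; apply.
have o0 : 0 < (omega%:R : R) by rewrite ltr0n; lia.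
set x := 1 / eps; have x0 : 0 < x by rewrite divr_gt0.
(* The power of [omega] enters only through this bound; the growth in [1 / eps] is carried by
   [powR x x]. *)
have omega_factor : 1 <= omega%:R * powR omega%:R (omega%:R / eps - 1).
  have p0 : 0 < omega%:R / eps by rewrite divr_gt0.
  rewrite (mulr_powRB1 (ltW o0) p0) -[leLHS](powRr0 omega%:R).
  by rewrite ler_powR ?(ltW p0) // ler1n; lia.
(* Since [K <= x + 1], the left side is at most [B] times [powR B x], to which [exp_le_self_power]
   applies. *)
have power : B%:R ^+ K <= B%:R * (expR B%:R * powR x x).
  rewrite -powR_mulrn ?(ltW B0) //.
  apply: (@le_trans _ _ (powR B%:R (x + 1))).
    by rewrite ler_powR // ler1n.
  rewrite addrC powRD ?(gt_eqF B0) ?implybT // powRr1 ?(ltW B0) //.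
  by rewrite ler_pM2l // exp_le_self_power.
rewrite /T -/x /C 2!natrM !natrX !natrM.
set c := _ * (2 + g)%:R; have c0 : 0 <= c by rewrite mulr_ge0.
set u := powR omega%:R _ in omega_factor *.
have -> : c * B%:R * B%:R * expR B%:R * omega%:R * (n%:R ^+ 2 * u * powR x x) =
    (c * B%:R * n%:R ^+ 2) * (B%:R * (expR B%:R * powR x x)) * (omega%:R * u) by ring.
have D0 : 0 <= c * B%:R * n%:R ^+ 2 by rewrite !mulr_ge0 ?exprn_ge0.
apply: le_trans (ler_wpM2l D0 power) _.
by rewrite ler_peMr // mulr_ge0 // (le_trans _ power) // exprn_ge0.
Qed.
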